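(* Let $n,\ell\ge1$, let $k=(k_1,\dots,k_\ell)$ be a partition of $n$, let $p\in\mathbb{Z}^n$ satisfy $|p_{(j)}|=0$ for every $j=1,\dots,\ell$, let $a\in L^\infty(\mathbb{R}_+^\ell)$ and let $b_j\in L^\infty(\mathbb{R}_+^\ell\times S_+^{k_j-1})$ for $j=1,\dots,\ell$. Let $T_a$ be the Toeplitz operator with symbol $z\mapsto a(r_1,\dots,r_\ell)$ and, for $j=1,\dots,\ell$, let $T_{b_jt_{(j)}^{p_{(j)}}}$ be the Toeplitz operator with symbol $z\mapsto b_j(r_1,\dots,r_\ell,s_{(j)})\,t_{(j)}^{p_{(j)}}$. Then the operators $T_a,T_{b_1t_{(1)}^{p_{(1)}}},\dots,T_{b_\ell t_{(\ell)}^{p_{(\ell)}}}$ pairwise commute on every weighted Bergman space $\mathcal{A}^2_m(\mathbb{P}^n(\mathbb{C}))$, $m\in\mathbb{N}$.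
   Context: Bergman space and Toeplitz operators. $\mathbb{N}=\{0,1,2,\dots\}$, $\mathbb{R}_+=[0,\infty)$. $\mathbb{C}^n$ is embedded in $\mathbb{P}^n(\mathbb{C})$ by $z\mapsto[1,z]$ (complement of measure zero), so $L^\infty(\mathbb{P}^n(\mathbb{C}))=L^\infty(\mathbb{C}^n)$. For $m\in\mathbb{N}$ the weighted Bergman space $\mathcal{A}^2_m(\mathbb{P}^n(\mathbb{C}))$ is identified with the space $\mathcal{P}_m(\mathbb{C}^n)$ of holomorphic polynomials on $\mathbb{C}^n$ of degree at most $m$, a closed subspace of $L^2(\mathbb{C}^n,\nu_m)$, where $$d\nu_m(z)=\frac{(n+m)!}{\pi^n m!}\frac{dV(z)}{(1+|z_1|^2+\dots+|z_n|^2)^{n+m+1}}$$ and $dV$ is Lebesgue measure. With $B_m:L^2(\mathbb{C}^n,\nu_m)\to\mathcal{P}_m(\mathbb{C}^n)$ the orthogonal projection, $T_\psi f=B_m(\psi f)$ for $\psi\in L^\infty(\mathbb{C}^n)$, $f\in\mathcal{P}_m(\mathbb{C}^n)$. For an integer multi-index (possibly with negative entries), $|\cdot|$ denotes the sum of its entries. Coordinates. A partition of $n$ is $k=(k_1,\dots,k_\ell)$ with integers $k_j\ge1$, $k_1+\dots+k_\ell=n$. It splits every $n$-tuple $z$ (or multi-index) into consecutive blocks $z_{(j)}=(z_{j,1},\dots,z_{j,k_j})$, $j=1,\dots,\ell$. For $z\in\mathbb{C}^n$ put $r_j=|z_{(j)}|$ (Euclidean norm), $s_{j,l}=|z_{j,l}|/r_j$,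 $t_{j,l}=z_{j,l}/|z_{j,l}|$ (defined a.e.), $s_{(j)}=(s_{j,1},\dots,s_{j,k_j})\in S_+^{k_j-1}$, $t_{(j)}=(t_{j,1},\dots,t_{j,k_j})$, $t_{(j)}^{p_{(j)}}=\prod_lt_{j,l}^{p_{j,l}}$. Here $S_+^{k_j-1}$ is the set of points of the unit sphere of $\mathbb{R}^{k_j}$ with nonnegative coordinates. *)

(* Defs.v *)
From HB Require Import structures.
From mathcomp Require Import all_boot all_order all_algebra.
From mathcomp Require Import complex.
From mathcomp Require Import -(notations) mpoly.
From mathcomp Require Import all_classical all_reals all_analysis.
From mathcomp Require Import measurable_realfun.

Set Implicit Arguments.
Unset Strict Implicit.
Unset Printing Implicit Defensive.

Import Order.TTheory GRing.Theory Num.Theory.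
Import numFieldNormedType.Exports.
Import ComplexField.Normc.

Local Open Scope classical_set_scope.
Local Open Scope ring_scope.
Local Open Scope complex_scope.

(* The Borel sigma-algebra of C, transported from R * R. *)
Definition complex_display : measure_display.
Proof. exact: default_measure_display. Qed.

Section complex_measurable.
Context {R : realType}.

Definition complex_of_pair (x : measurableTypeR R * measurableTypeR R) : R[i] :=
  x.1 +i* x.2.
Definition pair_of_complex (z : R[i]) : measurableTypeR R * measurableTypeR R :=
  (complex.Re z, complex.Im z).

Definition complex_measurable : set (set R[i]) :=
  [set A | measurable (complex_of_pair @^-1` A)].

Let complex_measurable0 : complex_measurable set0.
Proof. by rewrite /complex_measurable /= preimage_set0. Qed.

Let complex_measurableC A : complex_measurable A -> complex_measurable (~` A).
Proof. by rewrite /complex_measurable /= preimage_setC; exact: measurableC. Qed.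

Let complex_measurable_bigcup (F : (set R[i])^nat) :
  (forall i, complex_measurable (F i)) -> complex_measurable (\bigcup_i F i).
Proof.
by move=> mF; rewrite /complex_measurable /= preimage_bigcup;
  exact: bigcupT_measurable.
Qed.

HB.instance Definition _ := isPointed.Build R[i] 0.
HB.instance Definition _ := @isMeasurable.Build complex_display R[i]
  complex_measurable complex_measurable0 complex_measurableC
  complex_measurable_bigcup.

Lemma measurable_complex_of_pair : measurable_fun setT complex_of_pair.
Proof. by move=> _ A mA; rewrite setTI. Qed.

Lemma pair_of_complexK : cancel pair_of_complex complex_of_pair.
Proof. by case. Qed.

Lemma complex_of_pairK : cancel complex_of_pair pair_of_complex.
Proof. by case. Qed.

Lemma measurable_pair_of_complex : measurable_fun setT pair_of_complex.
Proof.
move=> _ A mA; rewrite setTI /measurable /= /complex_measurable /=.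
by rewrite -comp_preimage (_ : pair_of_complex \o complex_of_pair = id) //; apply/funext; case.
Qed.

End complex_measurable.

Section pushforward.
Context d1 d2 (T1 : measurableType d1) (T2 : measurableType d2) (R : realType).
Variables (f : T1 -> T2) (mf : measurable_fun setT f).

Definition pushforward_measure (mu : {measure set T1 -> \bar R}) :
    {measure set T2 -> \bar R} :=
  measure_function_pushforward__canonical__measure_function_Measure mu mf.

Lemma pushforward_sigma_finite (mu : {measure set T1 -> \bar R})
    (g : T2 -> T1) : measurable_fun setT g -> cancel f g ->
  sigma_finite setT mu -> sigma_finite setT (pushforward mu f).
Proof.
move=> mg fK [F FT mF]; exists (fun i => g @^-1` F i).
  by rewrite -preimage_bigcup -FT preimage_setT.
move=> i; split.
  by rewrite -[X in measurable X]setTI; apply: mg => //; case: (mF i).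
rewrite /pushforward -comp_preimage (_ : g \o f = id); last first.
  by apply/funext => x /=; rewrite fK.
by case: (mF i).
Qed.

End pushforward.

Lemma product_sigma_finite d1 d2 (T1 : measurableType d1)
    (T2 : measurableType d2) (R : realType)
    (m1 : {sigma_finite_measure set T1 -> \bar R})
    (m2 : {sigma_finite_measure set T2 -> \bar R}) :
  sigma_finite setT (m1 \x m2)%E.
Proof.
have /sigma_finiteP[F [TF ndF Foo]] := sigma_finiteT m1.
have /sigma_finiteP[G [TG ndG Goo]] := sigma_finiteT m2.
exists (fun n => F n `*` G n).
  rewrite -setXTT TF TG predeqE => -[x y]; split.
    move=> [/= [n _ Fnx] [k _ Gky]]; exists (maxn n k) => //; split.
    - by move: x Fnx; exact/subsetPset/ndF/leq_maxl.
    - by move: y Gky; exact/subsetPset/ndG/leq_maxr.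
  by move=> [n _ []/= ? ?]; split; exists n.
move=> k; have [? ?] := Foo k; have [? ?] := Goo k.
split; first exact: measurableX.
by rewrite product_measure1E// lte_mul_pinfty// ge0_fin_numE.
Qed.

Section lebesgueC.
Context {R : realType}.

Definition lebesgueC : set R[i] -> \bar R :=
  pushforward (@lebesgue_measure R \x @lebesgue_measure R)%E complex_of_pair.

HB.instance Definition _ := Measure.copy lebesgueC
  (pushforward_measure measurable_complex_of_pair
     (@lebesgue_measure R \x @lebesgue_measure R)%E).

Let lebesgueC_sigma_finite : sigma_finite setT lebesgueC.
Proof.
apply: (@pushforward_sigma_finite _ _ _ _ _ _ _ pair_of_complex).
- exact: measurable_pair_of_complex.
- exact: complex_of_pairK.
- exact: product_sigma_finite.
Qed.

HB.instance Definition _ :=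
  Measure_isSigmaFinite.Build _ _ _ lebesgueC lebesgueC_sigma_finite.

End lebesgueC.

(* The n-fold product of a sigma-finite measure, on the space of n-tuples. *)
Section tuple_measure.
Context d (T : measurableType d) (R : realType).
Variable mu : {sigma_finite_measure set T -> \bar R}.

Definition tuple_cons n (x : T * n.-tuple T) : n.+1.-tuple T :=
  [tuple of x.1 :: x.2].
Definition tuple_uncons n (x : n.+1.-tuple T) : T * n.-tuple T :=
  (thead x, [tuple of behead x]).

Lemma measurable_tuple_cons n : measurable_fun setT (@tuple_cons n).
Proof. by apply: measurable_cons. Qed.

Lemma measurable_tuple_uncons n : measurable_fun setT (@tuple_uncons n).
Proof.
apply/measurable_fun_pairP; split => /=.
  exact: measurable_tnth.
exact: measurable_behead.
Qed.

Lemma tuple_consK n : cancel (@tuple_cons n) (@tuple_uncons n).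
Proof.
by case=> x t; rewrite /tuple_uncons theadE; congr (_, _); exact/val_inj.
Qed.

Definition measure_cons n (nu : {sigma_finite_measure set (n.-tuple T) -> \bar R})
  : set (n.+1.-tuple T) -> \bar R := pushforward (mu \x nu)%E (@tuple_cons n).

HB.instance Definition _ n nu := Measure.copy (@measure_cons n nu)
  (pushforward_measure (@measurable_tuple_cons n) (mu \x nu)%E).

Let measure_cons_sigma_finite n nu : sigma_finite setT (@measure_cons n nu).
Proof.
apply: (@pushforward_sigma_finite _ _ _ _ _ _ _ (@tuple_uncons n)).
- exact: measurable_tuple_uncons.
- exact: tuple_consK.
- exact: product_sigma_finite.
Qed.

HB.instance Definition _ n nu := Measure_isSigmaFinite.Build _ _ _
  (@measure_cons n nu) (@measure_cons_sigma_finite n nu).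

Fixpoint tuple_measure n : {sigma_finite_measure set (n.-tuple T) -> \bar R} :=
  match n return {sigma_finite_measure set (n.-tuple T) -> \bar R} with
  | 0 => \d_ [tuple]
  | n'.+1 => measure_cons (tuple_measure n')
  end.

End tuple_measure.

Definition lebesgue_real {R : realType} (n : nat) :
    {sigma_finite_measure set (n.-tuple (measurableTypeR R)) -> \bar R} :=
  tuple_measure lebesgue_measure n.

Definition lebesgue_complex {R : realType} (n : nat) :
    {sigma_finite_measure set (n.-tuple R[i]) -> \bar R} :=
  tuple_measure lebesgueC n.

Section sphere.
Context {R : realType}.
Local Notation RR := (measurableTypeR R).

Definition enorm n (x : n.-tuple RR) : R :=
  Num.sqrt (\sum_(i < n) tnth x i ^+ 2).

(* x / |x|; at the origin, where x / |x| is undefined, the value is the first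
   basis vector, so that the image is in the sphere for every n > 0. *)
Definition normalize n (x : n.-tuple RR) : n.-tuple RR :=
  [tuple if enorm x == 0 then (i == 0 :> nat)%:R else tnth x i / enorm x
  | i < n].

Definition positive_orthant n : set (n.-tuple RR) :=
  [set x | forall i, 0 <= tnth x i].

Definition positive_sphere n : set (n.-tuple RR) :=
  [set x | positive_orthant x /\ enorm x = 1].

Definition punctured_ball n : set (n.-tuple RR) :=
  [set x | 0 < enorm x <= 1].

Lemma measurable_enorm n : measurable_fun setT (@enorm n).
Proof.
apply: measurableT_comp.
  by apply: continuous_measurable_fun; exact: sqrt_continuous.
apply: measurable_sum => i; apply: measurable_funX; exact: measurable_tnth.
Qed.

Lemma measurable_normalize n : measurable_fun setT (@normalize n).
Proof.
apply/measurable_fun_tnthP => i.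
rewrite (_ : _ \o _ = fun x : n.-tuple RR => if enorm x == 0
  then (i == 0 :> nat)%:R else tnth x i / enorm x); last first.
  by apply/funext => x; rewrite /= tnth_mktuple.
have mE : measurable_fun setT (@enorm n) by exact: measurable_enorm.
have mI : measurable_fun setT (fun x : n.-tuple RR => (enorm x)^-1 : R).
  rewrite (_ : (fun x => _) = (fun r : R => r `^ (-1)) \o @enorm n); last first.
    by apply/funext => x /=; rewrite powR_inv1// sqrtr_ge0.
  by apply: measurableT_comp => //; exact: measurable_powR.
have mT : measurable_fun setT (fun x : n.-tuple RR => tnth x i : R).
  exact: measurable_tnth.
have : measurable_fun setT (fun x : n.-tuple RR =>
    if enorm x == 0 then (i == 0 :> nat)%:R : R else tnth x i / enorm x : R).
  apply: measurable_fun_ifT => //; first exact: measurable_fun_eqr.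
  exact: measurable_funM.
exact.
Qed.

Lemma measurable_punctured_ball n : measurable (@punctured_ball n).
Proof.
rewrite (_ : @punctured_ball n = @enorm n @^-1` `]0, 1]); last first.
  by apply/seteqP; split => x; rewrite /= in_itv.
rewrite -[X in measurable X]setTI; exact: measurable_enorm.
Qed.

Let cube n : set (n.-tuple RR) := [set x | forall i, -1 <= tnth x i <= 1].

Let measurable_cube n : measurable (@cube n).
Proof.
rewrite (_ : @cube n = \bigcap_(i in [set: 'I_n])
    ((fun x : n.-tuple RR => tnth x i) @^-1` `[-1, 1]%classic)).
  apply: fin_bigcap_measurable => // i _.
  by rewrite -[X in measurable X]setTI; exact: measurable_tnth.
apply/seteqP; split => x /= xi i.
  by move=> _; rewrite /= in_itv/=; exact: xi.
by have := xi i Logic.I; rewrite /= in_itv.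
Qed.

Let lebesgue_real_cube n : (lebesgue_real n (@cube n) < +oo)%E.
Proof.
elim: n => [|n IH].
  by rewrite /= diracE ltry.
rewrite /= /measure_cons /pushforward.
rewrite (_ : _ @^-1` _ = (`[-1, 1]%classic : set RR) `*` @cube n); last first.
  apply/seteqP; split=> [[x t] /= xt|[x t] /= [x1 t1] i].
    split; first by have := xt ord0; rewrite tnth0 in_itv.
    by move=> i; have := xt (lift ord0 i); rewrite tnthS.
  move: x1; rewrite in_itv/= => x1.
  case: (unliftP ord0 i) => [j ->|->]; rewrite /tuple_cons ?tnthS ?tnth0//.
rewrite product_measure1E//; last exact: measurable_cube.
have I1 : (@lebesgue_measure R `[(-1)%R, 1%R]%classic < +oo)%E.
  by rewrite lebesgue_measure_itv/=; case: ifP => _; rewrite ltry.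
by apply: lte_mul_pinfty => //; rewrite ge0_fin_numE.
Qed.

(* Surface measure of the unit sphere of R^n, as a measure on R^n: the surface
   area of E is n times the volume of the cone {t x | x in E, 0 < t <= 1}. *)
Definition sphere_measure n (E : set (n.-tuple RR)) : \bar R :=
  (n%:R%:E * lebesgue_real n
    [set x | punctured_ball x /\ E (normalize x)])%E.

Let sphere_measureE n : @sphere_measure n = mscale n%:R%:nng
  (pushforward_measure (@measurable_normalize n)
     (mrestr (lebesgue_real n) (@measurable_punctured_ball n))).
Proof.
apply/funext => E; rewrite /mscale /= /pushforward /mrestr /sphere_measure.
by rewrite setIC.
Qed.

Let sphere_measure0 n : @sphere_measure n set0 = 0%E.
Proof. by rewrite sphere_measureE measure0. Qed.

Let sphere_measure_ge0 n E : (0 <= @sphere_measure n E)%E.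
Proof. by rewrite sphere_measureE. Qed.

Let sphere_measure_sigma_additive n : semi_sigma_additive (@sphere_measure n).
Proof. by rewrite sphere_measureE; exact: measure_semi_sigma_additive. Qed.

HB.instance Definition _ n := isMeasure.Build _ _ _ (@sphere_measure n)
  (@sphere_measure0 n) (@sphere_measure_ge0 n)
  (@sphere_measure_sigma_additive n).

Let sphere_measure_fin n : fin_num_fun (@sphere_measure n).
Proof.
move=> E mE; rewrite ge0_fin_numE ?measure_ge0//.
rewrite /sphere_measure lte_mul_pinfty// (le_lt_trans _ (lebesgue_real_cube n))//.
apply: le_measure; rewrite ?inE; last 1 first.
- move=> x [xb _] i; have /andP[_ x1] : 0 < enorm x <= 1 := xb.
  rewrite -ler_norml (le_trans _ x1)// -sqrtr_sqr ler_wsqrtr//.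
  by rewrite (bigD1 i)//= lerDl sumr_ge0// => j _; exact: sqr_ge0.
- apply: measurableI; first exact: measurable_punctured_ball.
  by rewrite -[X in measurable X]setTI; exact: measurable_normalize.
- exact: measurable_cube.
Qed.

HB.instance Definition _ n := Measure_isFinite.Build _ _ _ (@sphere_measure n)
  (@sphere_measure_fin n).

End sphere.

Section bergman.
Context {R : realType}.
Local Notation C := R[i].

Definition complex_integral d (T : measurableType d)
    (mu : {measure set T -> \bar R}) (f : T -> C) : C :=
  (\int[mu]_x complex.Re (f x)) +i* (\int[mu]_x complex.Im (f x)).

(* Classes are represented by measurable functions; outside D the values of f
   are irrelevant. *)
Definition Linfty d (T : measurableType d) (mu : {measure set T -> \bar R})
    (D : set T) (f : T -> C) : Prop :=
  measurable_fun D f /\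
  exists M : R, {ae mu, forall x, D x -> normc (f x) <= M}.

Variables n m : nat.

(* Density of nu_m with respect to the Lebesgue measure of C^n. *)
Definition bergman_weight (z : n.-tuple C) : R :=
  (n + m)`!%:R / (pi ^+ n * m`!%:R) /
  (1 + \sum_(i < n) normc (tnth z i) ^+ 2) ^+ (n + m + 1).

Definition bergman_dot (f g : n.-tuple C -> C) : C :=
  complex_integral (lebesgue_complex n)
    (fun z => f z * (g z)^* * (bergman_weight z)%:C).

Definition bergman_space : set (n.-tuple C -> C) :=
  [set f | exists2 q : mpoly.mpoly n C,
    {in mpoly.msupp q, forall e, (mpoly.mdeg e <= m)%N} &
    f = fun z => mpoly.meval (tnth z) q].

Definition bergman_projection (u : n.-tuple C -> C) : n.-tuple C -> C :=
  xget (fun=> 0) [set g | bergman_space g /\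
    forall h, bergman_space h -> bergman_dot (u \- g) h = 0].

Definition toeplitz (psi f : n.-tuple C -> C) : n.-tuple C -> C :=
  bergman_projection (psi \* f).

Definition commute_on_bergman
    (S T : (n.-tuple C -> C) -> (n.-tuple C -> C)) : Prop :=
  forall f, bergman_space f -> S (T f) = T (S f).

End bergman.

Section coordinates.
Context {R : realType}.
Local Notation C := R[i].
Local Notation RR := (measurableTypeR R).

Definition moduli d (w : d.-tuple C) : d.-tuple RR :=
  [tuple normc (tnth w i) | i < d].

Definition phase_monomial d (w : d.-tuple C) (q : 'I_d -> int) : C :=
  \prod_(i < d) (tnth w i / (normc (tnth w i))%:C) ^ q i.

Variables (n l : nat) (k : 'I_l -> nat) (kn : (\sum_(j < l) k j)%N = n).

(* The i-th index of the j-th block, i.e. the number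
   \sum_(j' < l | j' < j) k j' + i. *)
Definition block_index (j : 'I_l) (i : 'I_(k j)) : 'I_n :=
  cast_ord kn (tagnat.Rank j i).

Definition block (z : n.-tuple C) (j : 'I_l) : (k j).-tuple C :=
  [tuple tnth z (block_index i) | i < k j].

Definition radii (z : n.-tuple C) : l.-tuple RR :=
  [tuple enorm (moduli (block z j)) | j < l].

Definition radial_symbol (a : l.-tuple RR -> C) (z : n.-tuple C) : C :=
  a (radii z).

Definition block_symbol (p : 'I_n -> int) (j : 'I_l)
    (b : l.-tuple RR * (k j).-tuple RR -> C) (z : n.-tuple C) : C :=
  b (radii z, normalize (moduli (block z j))) *
  phase_monomial (block z j) (fun i => p (block_index i)).

End coordinates.

(* Main.v *)
Require Import Defs.
From HB Require Import structures.
From mathcomp Require Import all_boot all_order all_algebra.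
From mathcomp Require Import complex.
From mathcomp Require Import -(notations) mpoly.
From mathcomp Require Import all_classical all_reals all_analysis.
From mathcomp Require Import measurable_realfun ring lra zify.

Import Order.TTheory GRing.Theory Num.Theory.
Import numFieldNormedType.Exports.
Import ComplexField.Normc.

Set Implicit Arguments.
Unset Strict Implicit.
Unset Printing Implicit Defensive.

Local Open Scope classical_set_scope.
Local Open Scope ring_scope.
Local Open Scope complex_scope.

(* The symbols are multiplied by a character when one coordinate is multiplied
   by a unimodular number, so the Toeplitz operator of block j maps the monomial
   z^e to a multiple gamma_j(e) of z^(e + p_(j)). Its symbol is moreover
   invariant under real rotations of a plane (z_u, z_v) inside a block i <> j,
   and comparing coefficients in the expansion of the rotated z_u^N shows that
   gamma_j(e) depends on the i-th block of e only through its sum. As p_(i) has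
   sum 0 this gives gamma_j(e + p_(i)) = gamma_j(e), which is the commutation of
   the two weighted shifts. *)

(** * Maps multiplying a measure by a constant *)

(** The constants in the coefficient comparison depend on the exponents and on the rotation, but not
    on the symbol. The symbol 1 therefore satisfies the same relation, and dividing by it turns a
    relation between pairings into an equality of normalised coefficients. One rational rotation is
    enough, because every coefficient of (a x - b y)^N is nonzero as soon as a and b are. The
    analytic obstacle is that a and b_j are bounded only off null sets of polar coordinates, while
    all pairings are integrals over C^n. No change of variables to polar coordinates is made: null
    sets are carried to C^n by Tonelli along dilations, invariance of Lebesgue measure under
    rotations comes from shears, and integrability of the weight comes from a geometric series over
    growing cubes. *)

(** Formulated with preimages, so that no measurable inverse of [f] is required. For a dilation [c]
    is the reciprocal of the Jacobian. *)
Definition scales d (T : measurableType d) (R : realType)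
    (mu : set T -> \bar R) (f : T -> T) (c : R) : Prop :=
  [/\ 0 < c, measurable_fun setT f &
  forall A, measurable A -> mu (f @^-1` A) = (c%:E * mu A)%E].

Section scales_theory.
Context d (T : measurableType d) (R : realType).
Implicit Types (mu : set T -> \bar R) (f g : T -> T) (c : R).

Lemma scales_comp mu f g c c' :
  scales mu f c -> scales mu g c' -> scales mu (f \o g) (c' * c).
Proof.
move=> [c0 mf sf] [c0' mg sg]; split; first exact: mulr_gt0.
  exact: measurableT_comp.
move=> A mA; rewrite comp_preimage sg ?sf ?EFinM ?muleA//.
by rewrite -[X in measurable X]setTI; exact: mf.
Qed.

Lemma scales_null_inv mu f c A :
  scales mu f c -> measurable A -> mu (f @^-1` A) = 0%E -> mu A = 0%E.
Proof.
move=> [c0 _ sf] mA; rewrite sf// => /eqP.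
by rewrite mule_eq0 eqe gt_eqF// => /eqP.
Qed.

End scales_theory.

Section lebesgue_scales.
Context {R : realType}.
Local Notation RR := (measurableTypeR R).

Let measurable_affine (c t : R) :
  measurable_fun setT (fun x : RR => c * x + t : RR).
Proof.
by apply: measurable_funD => //; apply: measurable_funM => //.
Qed.

(** The pushforward multiplied by [c] agrees with Lebesgue measure on half-open intervals, hence on
    all measurable sets. *)
Lemma scales_lebesgue_affine (c t : R) : 0 < c ->
  scales (@lebesgue_measure R) (fun x : RR => c * x + t : RR) c^-1.
Proof.
move=> c0; have mf := measurable_affine c t; split; rewrite ?invr_gt0// => A mA.
have c0' : 0 <= c by exact: ltW.
pose nu := mscale (NngNum c0') (pushforward_measure mf (@lebesgue_measure R)).
have nuE B : nu B =
  (c%:E * lebesgue_measure ((fun x : RR => (c * x + t)%R : RR) @^-1` B))%E by [].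
suff -> : lebesgue_measure A = nu A.
  by rewrite nuE muleA -EFinM mulVf ?gt_eqF// mul1e.
apply: lebesgue_measure_unique => // _ [[a b]] _ <- /=.
have E : (fun x : RR => c * x + t : RR) @^-1` [set` `]a, b]] =
    [set` `](a - t) / c, (b - t) / c]].
  by apply/seteqP; split => x /=;
    rewrite !in_itv/= ler_pdivlMr// ltr_pdivrMr// lerBrDr ltrBlDr (mulrC x).
rewrite [RHS]nuE E !lebesgue_measure_itv/= !lte_fin ltr_pM2r ?invr_gt0// ltrD2r.
case: ifP => _; last by rewrite mule0.
rewrite -!EFinD -EFinM; congr (_%:E).
by field; rewrite gt_eqF.
Qed.

Lemma scales_lebesgueM (c : R) : 0 < c ->
  scales (@lebesgue_measure R) (fun x : RR => c * x : RR) c^-1.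
Proof.
move=> /(scales_lebesgue_affine 0).
by under [fun x => _ + _]eq_fun do rewrite addr0.
Qed.

Lemma scales_lebesgueD (t : R) :
  scales (@lebesgue_measure R) (fun x : RR => x + t : RR) 1.
Proof.
have := @scales_lebesgue_affine 1 t ltr01; rewrite invr1.
by under [fun x => _ + _]eq_fun do rewrite mul1r.
Qed.

End lebesgue_scales.

Section product_scales.
Context d1 d2 (T1 : measurableType d1) (T2 : measurableType d2) (R : realType).
Variables (mu : {sigma_finite_measure set T1 -> \bar R})
          (nu : {sigma_finite_measure set T2 -> \bar R}).

(** Tonelli for indicator functions: both iterated integrals have the same values on rectangles. *)
Lemma product_measureC A : measurable A -> (mu \x nu)%E A = (mu \x^ nu)%E A.
Proof.
move=> mA; apply: product_measure_unique => // B C mB mC.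
by rewrite /= product_measure2E.
Qed.

(** Cavalieri's principle: the slice at [x] of the preimage of [A] is the preimage of the slice of
    [A]. As [phi] may depend on [x], shears are covered; only the factor [c] has to be common to all
    fibres. *)
Lemma scales_fiber2 (phi : T1 * T2 -> T2) (c : R) :
  measurable_fun setT phi ->
  (forall x, scales nu (fun y => phi (x, y)) c) ->
  scales (mu \x nu)%E (fun u => (u.1, phi u)) c.
Proof.
move=> mphi sphi; have [c0 _ _] := sphi point.
have mf : measurable_fun setT (fun u : T1 * T2 => (u.1, phi u)).
  exact: measurable_fun_pair.
split => // A mA.
rewrite /product_measure1.
have := @ge0_integralZl _ _ _ mu _ measurableT _ (measurable_fun_xsection nu mA).
move=> <- //; last exact: ltW.
apply: eq_integral => x _ /=.
have [_ _ /(_ _ (measurable_xsection x mA)) <-] := sphi x.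
by congr (nu _); apply/seteqP; split=> y; rewrite /xsection/= !inE.
Qed.

Lemma scales_fiber1 (phi : T1 * T2 -> T1) (c : R) :
  measurable_fun setT phi ->
  (forall y, scales mu (fun x => phi (x, y)) c) ->
  scales (mu \x nu)%E (fun u => (phi u, u.2)) c.
Proof.
move=> mphi sphi; have [c0 _ _] := sphi point.
have mf : measurable_fun setT (fun u : T1 * T2 => (phi u, u.2)).
  exact: measurable_fun_pair.
split => // A mA.
(* The slices now lie in the first factor, so both sides are computed by the other iterated
   integral. *)
rewrite [LHS]product_measureC; last first.
  by rewrite -[X in measurable X]setTI; exact: mf.
rewrite [X in (_ * X)%E]product_measureC// /product_measure2.
have := @ge0_integralZl _ _ _ nu _ measurableT _ (measurable_fun_ysection mu mA).
move=> <- //; last exact: ltW.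
apply: eq_integral => y _ /=.
have [_ _ /(_ _ (measurable_ysection y mA)) <-] := sphi y.
by congr (mu _); apply/seteqP; split=> x; rewrite /ysection/= !inE.
Qed.

End product_scales.

Section tuple_scales.
Context d (T : measurableType d) (R : realType).
Variable mu : {sigma_finite_measure set T -> \bar R}.
Local Notation tmu := (tuple_measure mu).

Lemma tuple_measureSE n A :
  tmu n.+1 A = (mu \x tmu n)%E (@tuple_cons _ T n @^-1` A).
Proof. by []. Qed.

Lemma measurable_preimage_tuple_cons n (A : set (n.+1.-tuple T)) :
  measurable A -> measurable (@tuple_cons _ T n @^-1` A).
Proof.
by move=> mA; rewrite -[X in measurable X]setTI; exact: measurable_tuple_cons.
Qed.

Definition tuple_set n (z : n.-tuple T) (u : 'I_n) (x : T) : n.-tuple T :=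
  [tuple if i == u then x else tnth z i | i < n].

Lemma measurable_tuple_set d' (T' : measurableType d') n
    (f : T' -> n.-tuple T) u (g : T' -> T) :
  measurable_fun setT f -> measurable_fun setT g ->
  measurable_fun setT (fun x => tuple_set (f x) u (g x)).
Proof.
move=> mf mg; apply/measurable_fun_tnthP => i.
rewrite (_ : _ \o _ = if i == u then g else fun x => tnth (f x) i).
  case: ifP => // _.
  exact: (measurableT_comp (measurable_tnth i) mf).
by apply/funext => x /=; rewrite tnth_mktuple; case: ifP.
Qed.

Lemma tuple_set_cons0 n (x y : T) (t : n.-tuple T) :
  tuple_set (tuple_cons (x, t)) ord0 y = tuple_cons (y, t).
Proof.
apply: eq_from_tnth => i; rewrite tnth_mktuple.
by case: (unliftP ord0 i) => [j ->|->]; rewrite /tuple_cons ?tnthS ?tnth0.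
Qed.

Lemma tuple_set_consS n (x y : T) (t : n.-tuple T) u :
  tuple_set (tuple_cons (x, t)) (lift ord0 u) y = tuple_cons (x, tuple_set t u y).
Proof.
apply: eq_from_tnth => i; rewrite tnth_mktuple.
case: (unliftP ord0 i) => [j ->|->]; rewrite /tuple_cons ?tnthS ?tnth0//.
by rewrite tnth_mktuple (inj_eq lift_inj).
Qed.

(** The new entry may depend on all the old ones, so this contains shears as well as rotations of
    one coordinate. The induction peels off the head: it is the moving coordinate ([scales_fiber1])
    or a parameter ([scales_fiber2]). *)
Lemma scales_tuple_set n (u : 'I_n) (phi : n.-tuple T -> T) (c : R) :
  measurable_fun setT phi ->
  (forall z, scales mu (fun x => phi (tuple_set z u x)) c) ->
  scales (tmu n) (fun z => tuple_set z u (phi z)) c.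
Proof.
elim: n u phi => [[]//|n IH] u phi mphi sphi.
have [c0 _ _] := sphi point.
have mc := @measurable_tuple_cons _ T n.
split => //; first exact: measurable_tuple_set.
move=> A mA; rewrite !tuple_measureSE.
have mA' := measurable_preimage_tuple_cons mA.
have mphi' : measurable_fun setT (phi \o @tuple_cons _ T n).
  exact: measurableT_comp.
case: (unliftP ord0 u) sphi => [v ->|->] sphi.
- have [] := @scales_fiber2 _ _ _ _ _ mu (tmu n)
    (fun w => tuple_set w.2 v (phi (tuple_cons w))) c.
  + exact: measurable_tuple_set.
  + move=> x; apply: (IH v (fun t => phi (tuple_cons (x, t)))).
      exact: (measurableT_comp mphi' (pair1_measurable x)).
    move=> t; have := sphi (tuple_cons (x, t)).
    by under eq_fun do rewrite tuple_set_consS.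
  move=> _ _ /(_ _ mA') <-; congr ((_ \x _)%E _).
  by apply/seteqP; split => -[x t] /=; rewrite tuple_set_consS.
- have [] := @scales_fiber1 _ _ _ _ _ mu (tmu n)
    (phi \o @tuple_cons _ T n) c.
  + exact: mphi'.
  + move=> t; have := sphi (tuple_cons (point, t)).
    by under eq_fun do rewrite tuple_set_cons0.
  move=> _ _ /(_ _ mA') <-; congr ((_ \x _)%E _).
  by apply/seteqP; split => -[x t] /=; rewrite tuple_set_cons0.
Qed.

Lemma scales_tuple_map n (f : 'I_n -> T -> T) (c : 'I_n -> R) :
  (forall i, scales mu (f i) (c i)) ->
  scales (tmu n) (fun z => [tuple f i (tnth z i) | i < n]) (\prod_(i < n) c i).
Proof.
move=> sf; have c0 : 0 < \prod_(i < n) c i.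
  by apply: prodr_gt0 => i _; case: (sf i).
have mf : measurable_fun setT (fun z : n.-tuple T => [tuple f i (tnth z i) | i < n]).
  apply/measurable_fun_tnthP => i.
  rewrite (_ : _ \o _ = f i \o @tnth _ _ ^~ i).
    by apply: measurableT_comp; [case: (sf i)|exact: measurable_tnth].
  by apply/funext => z /=; rewrite tnth_mktuple.
split=> //.
elim: n f c sf c0 mf => [|n IH] f c sf c0 mf A mA.
  rewrite big_ord0 mul1e; congr (tmu 0 _).
  by apply/seteqP; split => z /=; rewrite [[tuple _ | _ < _]]tuple0 [z]tuple0.
rewrite tuple_measureSE big_ord_recl.
(* The map on n + 1 coordinates is a map of the tail followed by a map of the head. *)
have [cr mr sr] : scales (mu \x tmu n)%E
    (fun u => (u.1, [tuple f (lift ord0 i) (tnth u.2 i) | i < n]))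
    (\prod_(i < n) c (lift ord0 i)).
  have mt : measurable_fun setT
     (fun z : n.-tuple T => [tuple f (lift ord0 i) (tnth z i) | i < n]).
    apply/measurable_fun_tnthP => i.
    rewrite (_ : _ \o _ = f (lift ord0 i) \o @tnth _ _ ^~ i).
      by apply: measurableT_comp; [case: (sf (lift ord0 i))|exact: measurable_tnth].
    by apply/funext => z /=; rewrite tnth_mktuple.
  have cp : 0 < \prod_(i < n) c (lift ord0 i).
    by apply: prodr_gt0 => i _; case: (sf (lift ord0 i)).
  apply: (@scales_fiber2 _ _ _ _ _ mu (tmu n)
    (fun u => [tuple f (lift ord0 i) (tnth u.2 i) | i < n])).
    exact: (measurableT_comp mt measurable_snd).
  by move=> x; exact: (And3 cp mt (IH _ _ (fun i => sf (lift ord0 i)) cp mt)).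
have [_ m0 s0] : scales (mu \x tmu n)%E (fun u => (f ord0 u.1, u.2)) (c ord0).
  apply: (@scales_fiber1 _ _ _ _ _ mu (tmu n) (fun u => f ord0 u.1)) => //.
  by have [_ mf0 _] := sf ord0; exact: (measurableT_comp mf0 measurable_fst).
have mA' := measurable_preimage_tuple_cons mA.
rewrite tuple_measureSE mulrC EFinM -muleA -s0// -sr; last first.
  by rewrite -[X in measurable X]setTI; exact: m0.
congr ((_ \x _)%E _); apply/seteqP; split=> -[x t] /=;
  rewrite (_ : [tuple _ | i < n.+1] = tuple_cons (f ord0 x, [tuple f (lift ord0 i) (tnth t i) | i < n]))//;
  apply: eq_from_tnth => i; rewrite tnth_mktuple;
  by case: (unliftP ord0 i) => [j ->|->]; rewrite /tuple_cons ?tnthS ?tnth0// tnth_mktuple.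
Qed.

Lemma measurable_cube n (P : set T) : measurable P ->
  measurable [set z : n.-tuple T | forall i, P (tnth z i)].
Proof.
move=> mP; rewrite (_ : [set z | _] = \bigcap_(i in [set: 'I_n])
    ((fun z : n.-tuple T => tnth z i) @^-1` P)).
  apply: fin_bigcap_measurable => // i _.
  by rewrite -[X in measurable X]setTI; exact: measurable_tnth.
by apply/seteqP; split => x /= xi i; [move=> _|]; exact: xi.
Qed.

Lemma tuple_measure_cube n (P : set T) (r : R) : measurable P -> mu P = r%:E ->
  tmu n [set z | forall i, P (tnth z i)] = (r ^+ n)%:E.
Proof.
move=> mP Pr.
elim: n => [|n IH]; first by rewrite /= diracE mem_set//; case.
rewrite tuple_measureSE.
rewrite (_ : _ @^-1` _ = P `*` [set z : n.-tuple T | forall i, P (tnth z i)]).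
  rewrite product_measure1E//; last exact: measurable_cube.
  by rewrite exprS EFinM -Pr -IH.
apply/seteqP; split=> [[x t] /= xt|[x t] /= [x1 t1] i].
  by split=> [|i]; [have := xt ord0|have := xt (lift ord0 i)];
    rewrite /tuple_cons ?tnth0 ?tnthS.
by case: (unliftP ord0 i) => [j ->|->]; rewrite /tuple_cons ?tnthS ?tnth0.
Qed.

End tuple_scales.

(** * Measurability of complex-valued functions *)

Section complex_measurability.
Context {R : realType}.
Local Notation RR := (measurableTypeR R).
Local Notation C := R[i].
Context d (T : measurableType d).
Implicit Types f g : T -> C.

Lemma measurable_Re : measurable_fun setT (@complex.Re R : C -> RR).
Proof. exact: (measurableT_comp measurable_fst measurable_pair_of_complex). Qed.

Lemma measurable_Im : measurable_fun setT (@complex.Im R : C -> RR).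
Proof. exact: (measurableT_comp measurable_snd measurable_pair_of_complex). Qed.

Lemma measurable_complexP f : measurable_fun setT f <->
  measurable_fun setT (fun x => complex.Re (f x) : RR) /\
  measurable_fun setT (fun x => complex.Im (f x) : RR).
Proof.
split=> [mf|[mr mi]].
  by split; [exact: (measurableT_comp measurable_Re mf)|
             exact: (measurableT_comp measurable_Im mf)].
rewrite (_ : f = complex_of_pair \o (fun x => (complex.Re (f x), complex.Im (f x)))).
  apply: (measurableT_comp measurable_complex_of_pair).
  exact: (measurable_fun_pair mr mi).
by apply/funext => x /=; rewrite /complex_of_pair/=; case: (f x).
Qed.

Lemma measurable_funCD f g : measurable_fun setT f -> measurable_fun setT g ->
  measurable_fun setT (fun x => f x + g x).
Proof.
move=> /measurable_complexP[fr fi] /measurable_complexP[gr gi].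
apply/measurable_complexP; split.
  under eq_fun do rewrite raddfD; exact: measurable_funD.
under eq_fun do rewrite raddfD; exact: measurable_funD.
Qed.

Lemma Re_mulc (x y : C) : complex.Re (x * y) =
  complex.Re x * complex.Re y - complex.Im x * complex.Im y.
Proof. by case: x y => [? ?] [? ?]. Qed.

Lemma Im_mulc (x y : C) : complex.Im (x * y) =
  complex.Re x * complex.Im y + complex.Im x * complex.Re y.
Proof. by case: x y => [? ?] [? ?]. Qed.

Lemma measurable_funCM f g : measurable_fun setT f -> measurable_fun setT g ->
  measurable_fun setT (fun x => f x * g x).
Proof.
move=> /measurable_complexP[fr fi] /measurable_complexP[gr gi].
apply/measurable_complexP; split.
  under eq_fun do rewrite Re_mulc.
  by apply: measurable_funB; exact: measurable_funM.
under eq_fun do rewrite Im_mulc.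
by apply: measurable_funD; exact: measurable_funM.
Qed.

Lemma measurable_funC_conj f : measurable_fun setT f ->
  measurable_fun setT (fun x => (f x)^*%C).
Proof.
move=> /measurable_complexP[fr fi]; apply/measurable_complexP; split.
  by apply: (eq_measurable_fun _ _ fr) => x _; case: (f x).
apply: (eq_measurable_fun (fun x => - complex.Im (f x) : RR)).
  by move=> x _; case: (f x).
exact: measurable_funN.
Qed.

Lemma measurable_funC_real (f : T -> RR) : measurable_fun setT f ->
  measurable_fun setT (fun x => (f x)%:C : C).
Proof. move=> mf; apply/measurable_complexP; split => //=; exact: measurable_cst. Qed.

Lemma measurable_funCX f k : measurable_fun setT f ->
  measurable_fun setT (fun x => f x ^+ k).
Proof.
move=> mf; elim: k => [|k IH]; first by under eq_fun do rewrite expr0; exact: measurable_cst.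
by under eq_fun do rewrite exprS; exact: measurable_funCM.
Qed.

Lemma measurable_funC_prod (I : Type) (s : seq I) (F : I -> T -> C) :
  (forall i, measurable_fun setT (F i)) ->
  measurable_fun setT (fun x => \prod_(i <- s) F i x).
Proof.
move=> mF; elim: s => [|i s IH].
  by under eq_fun do rewrite big_nil; exact: measurable_cst.
by under eq_fun do rewrite big_cons; exact: measurable_funCM.
Qed.

Lemma measurable_funC_sum (I : Type) (s : seq I) (F : I -> T -> C) :
  (forall i, measurable_fun setT (F i)) ->
  measurable_fun setT (fun x => \sum_(i <- s) F i x).
Proof.
move=> mF; elim: s => [|i s IH].
  by under eq_fun do rewrite big_nil; exact: measurable_cst.
by under eq_fun do rewrite big_cons; exact: measurable_funCD.
Qed.

Lemma measurable_normc f : measurable_fun setT f ->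
  measurable_fun setT (fun x => normc (f x) : RR).
Proof.
move=> /measurable_complexP[fr fi].
apply: (eq_measurable_fun
    (fun x => Num.sqrt (complex.Re (f x) ^+ 2 + complex.Im (f x) ^+ 2) : RR)).
  by move=> x _; case: (f x).
apply: (measurableT_comp (f := @Num.sqrt R : RR -> RR)).
  by apply: continuous_measurable_fun; exact: sqrt_continuous.
by apply: measurable_funD; exact: measurable_funX.
Qed.

(** On nonnegative reals inversion is the power function of exponent -1, also at 0, where both are
    0. *)
Lemma measurable_funR_inv (f : T -> RR) : (forall x, 0 <= f x) ->
  measurable_fun setT f -> measurable_fun setT (fun x => (f x)^-1 : RR).
Proof.
move=> f0 mf; apply: (eq_measurable_fun (fun x => f x `^ (-1) : RR)).
  by move=> x _; rewrite powR_inv1.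
by apply: (measurableT_comp (measurable_powR _)).
Qed.

Lemma measurable_funC_div_norm f : measurable_fun setT f ->
  measurable_fun setT (fun x => f x / (normc (f x))%:C).
Proof.
move=> mf; apply: measurable_funCM => //.
apply: (eq_measurable_fun (fun x => ((normc (f x))^-1)%:C : C)).
  by move=> x _; rewrite fmorphV.
apply/measurable_funC_real/measurable_funR_inv; last exact: measurable_normc.
by move=> x; case: (f x) => ? ?; exact: sqrtr_ge0.
Qed.

End complex_measurability.

(** * Translations, dilations and rotations of the complex plane *)

Section lebesgueC_scales.
Context {R : realType}.
Local Notation RR := (measurableTypeR R).
Local Notation C := R[i].
Local Notation leb2 := (@lebesgue_measure R \x @lebesgue_measure R)%E.

Lemma scales_lebesgueC (f : RR * RR -> RR * RR) (g : C -> C) (c : R) :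
  (forall x, g (complex_of_pair x) = complex_of_pair (f x)) ->
  scales leb2 f c -> scales lebesgueC g c.
Proof.
move=> gf [c0 mf sf]; split=> //.
  rewrite (_ : g = complex_of_pair \o (f \o pair_of_complex)).
    apply: (measurableT_comp measurable_complex_of_pair).
    exact: (measurableT_comp mf measurable_pair_of_complex).
  by apply/funext => z; rewrite /= -gf pair_of_complexK.
move=> A mA; rewrite /lebesgueC /pushforward -sf.
  by congr (leb2 _); apply/seteqP; split=> x /=; rewrite gf.
by rewrite -[X in measurable X]setTI; exact: measurable_complex_of_pair.
Qed.

Let scales_shear1 (t : R) : scales leb2 (fun x => (x.1 + t * x.2 : RR, x.2)) 1.
Proof.
apply: (@scales_fiber1 _ _ _ _ _ lebesgue_measure lebesgue_measure
  (fun x => x.1 + t * x.2 : RR)).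
  by apply: measurable_funD => //; exact: measurable_funM.
by move=> y /=; exact: scales_lebesgueD.
Qed.

Let scales_shear2 (t : R) : scales leb2 (fun x => (x.1, x.2 + t * x.1 : RR)) 1.
Proof.
apply: (@scales_fiber2 _ _ _ _ _ lebesgue_measure lebesgue_measure
  (fun x => x.2 + t * x.1 : RR)).
  by apply: measurable_funD => //; exact: measurable_funM.
by move=> y /=; exact: scales_lebesgueD.
Qed.

Lemma scales_lebesgueCD (w : C) : scales lebesgueC (fun z : C => z + w) 1.
Proof.
rewrite -[1]mulr1.
apply: (@scales_lebesgueC ((fun x => (x.1 + complex.Re w : RR, x.2)) \o
  (fun x => (x.1, x.2 + complex.Im w : RR)))).
  by case: w => a b [x y].
apply: scales_comp.
  apply: (@scales_fiber1 _ _ _ _ _ lebesgue_measure lebesgue_measure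
    (fun x => x.1 + complex.Re w : RR)).
    exact: measurable_funD.
  by move=> y; exact: scales_lebesgueD.
apply: (@scales_fiber2 _ _ _ _ _ lebesgue_measure lebesgue_measure
  (fun x => x.2 + complex.Im w : RR)).
  exact: measurable_funD.
by move=> y; exact: scales_lebesgueD.
Qed.

Lemma scales_lebesgueCM (c : R) : 0 < c ->
  scales lebesgueC (fun z : C => c%:C * z) (c^-1 * c^-1).
Proof.
move=> c0.
apply: (@scales_lebesgueC ((fun x => (c * x.1 : RR, x.2)) \o
  (fun x => (x.1, c * x.2 : RR)))).
  by case=> x y; rewrite /complex_of_pair /=; simpc.
apply: scales_comp.
  apply: (@scales_fiber1 _ _ _ _ _ lebesgue_measure lebesgue_measure
    (fun x => c * x.1 : RR)).
    exact: measurable_funM.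
  by move=> y; exact: scales_lebesgueM.
apply: (@scales_fiber2 _ _ _ _ _ lebesgue_measure lebesgue_measure
  (fun x => c * x.2 : RR)).
  exact: measurable_funM.
by move=> y; exact: scales_lebesgueM.
Qed.

(** For a = cos theta and b = sin theta, [t] is -tan (theta / 2). The two expressions are the
    defects between a rotation and its product of three shears, for rotations of C and of a
    coordinate plane of C^n alike. *)
Lemma shear_slope (a b : R) (t := - b / (1 + a)) :
  a ^+ 2 + b ^+ 2 = 1 -> 1 + a != 0 ->
  a - 1 - t * b = 0 /\ - b - t * (1 + a) = 0.
Proof.
move=> ab a1; split; last by rewrite /t; field.
apply: (mulfI a1); rewrite mulr0 /t.
transitivity (a ^+ 2 + b ^+ 2 - 1); first by field.
by rewrite ab subrr.
Qed.

(* A rotation of angle theta <> pi is a product of three shears, of slopes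
   -tan (theta / 2), sin theta and -tan (theta / 2). *)
Lemma scales_lebesgueC_rotation (a b : R) : a ^+ 2 + b ^+ 2 = 1 -> 1 + a != 0 ->
  scales lebesgueC (fun z : C => (a +i* b) * z) 1.
Proof.
move=> ab a1; pose t := - b / (1 + a).
rewrite -[X in scales _ _ X](mulr1 1) -[X in X * _]mulr1.
apply: (@scales_lebesgueC ((fun x => (x.1 + t * x.2 : RR, x.2)) \o
  ((fun x => (x.1, x.2 + b * x.1 : RR)) \o (fun x => (x.1 + t * x.2 : RR, x.2))))).
  have [e1 e2] := shear_slope ab a1.
  case=> x y; rewrite /complex_of_pair /=; simpc.
  congr (_ +i* _); apply/eqP; rewrite -subr_eq0; apply/eqP.
    transitivity ((x + t * y) * (a - 1 - t * b) + y * (- b - t * (1 + a))).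
      by ring.
    by rewrite e1 e2 !mulr0 addr0.
  transitivity (y * (a - 1 - t * b)); first by ring.
  by rewrite e1 mulr0.
apply: scales_comp; first exact: scales_shear1.
by apply: scales_comp; [exact: scales_shear2|exact: scales_shear1].
Qed.

End lebesgueC_scales.

(** * Rotations of one coordinate and of a coordinate plane *)

Section torus_and_plane_rotations.
Context {R : realType}.
Local Notation C := R[i].
Variable n : nat.
Implicit Types z : n.-tuple C.

Definition phase_rotation (u : 'I_n) (c : C) z := tuple_set z u (c * tnth z u).

(** A real rotation acting on two complex coordinates. For distinct [u] and [v] it is unitary, so it
    preserves the Bergman weight; being complex-linear, it maps polynomials to polynomials without
    raising the degree. *)
Definition plane_rotation (u v : 'I_n) (a b : R) z : n.-tuple C :=
  [tuple if i == u then a%:C * tnth z u - b%:C * tnth z v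
         else if i == v then b%:C * tnth z u + a%:C * tnth z v
         else tnth z i | i < n].

Lemma scales_phase_rotation u (a b : R) : a ^+ 2 + b ^+ 2 = 1 -> 1 + a != 0 ->
  scales (lebesgue_complex n) (phase_rotation u (a +i* b)) 1.
Proof.
move=> ab a1; apply: scales_tuple_set.
  by apply: measurable_funCM; [exact: measurable_cst|exact: measurable_tnth].
move=> z; have := scales_lebesgueC_rotation ab a1.
by under [X in _ -> scales _ X _]eq_fun do rewrite tnth_mktuple eqxx.
Qed.

Let shear u v (t : R) z := tuple_set z u (tnth z u + t%:C * tnth z v).

Let scales_shear u v t : u != v -> scales (lebesgue_complex n) (shear u v t) 1.
Proof.
move=> uv; apply: scales_tuple_set.
  apply: measurable_funCD; first exact: measurable_tnth.
  by apply: measurable_funCM; [exact: measurable_cst|exact: measurable_tnth].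
move=> z; have := scales_lebesgueCD (t%:C * tnth z v).
under [X in _ -> scales _ X _]eq_fun do rewrite !tnth_mktuple eqxx eq_sym (negbTE uv).
by [].
Qed.

(** The three-shear factorisation with complex coordinates: each shear translates one coordinate by
    a multiple of the other. *)
Lemma scales_plane_rotation u v (a b : R) : u != v ->
  a ^+ 2 + b ^+ 2 = 1 -> 1 + a != 0 ->
  scales (lebesgue_complex n) (plane_rotation u v a b) 1.
Proof.
move=> uv ab a1; pose t := - b / (1 + a).
have vu : v != u by rewrite eq_sym.
rewrite -[X in scales _ _ X](mulr1 1) -[X in X * _]mulr1.
rewrite (_ : plane_rotation u v a b = shear u v t \o (shear v u b \o shear u v t)).
  apply: scales_comp; first exact: scales_shear.
  by apply: scales_comp; exact: scales_shear.
have [e1 e2] := shear_slope ab a1.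
apply/funext => z; apply: eq_from_tnth => i.
rewrite /plane_rotation /shear /tuple_set /= !tnth_mktuple !eqxx ?(negbTE uv) ?(negbTE vu) ?eqxx.
case: eqP => _; last case: eqP => // _;
  apply/eqP; rewrite -subr_eq0; apply/eqP.
  transitivity ((tnth z u + t%:C * tnth z v) * (a - 1 - t * b)%:C +
    tnth z v * (- b - t * (1 + a))%:C).
    by rewrite !(rmorphD, rmorphN, rmorphM, rmorph1); ring.
  by rewrite e1 e2 !mulr0 addr0.
transitivity (tnth z v * (a - 1 - t * b)%:C).
  by rewrite !(rmorphD, rmorphN, rmorphM, rmorph1); ring.
by rewrite e1 mulr0.
Qed.

End torus_and_plane_rotations.

(** * Null sets in polar coordinates *)

(* Fubini: the average over y in B of the measures of the preimages of A is 0,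
   hence one of them is null. Applied to dilations, this replaces the change of
   variables to polar coordinates. *)
Lemma null_of_null_orbits d1 d2 (X : measurableType d1) (Y : measurableType d2)
    (R : realType) (mu : {sigma_finite_measure set X -> \bar R})
    (nu : {sigma_finite_measure set Y -> \bar R})
    (alpha : Y * X -> X) (A : set X) (B : set Y) :
  measurable_fun setT alpha -> measurable A -> measurable B -> nu B <> 0%E ->
  (forall y, B y -> exists c, scales mu (fun x => alpha (y, x)) c) ->
  mu.-negligible [set x | nu [set y | B y /\ A (alpha (y, x))] <> 0%E] ->
  mu A = 0%E.
Proof.
move=> malpha mA mB nuB salpha nulls.
pose W := (B `*` setT) `&` alpha @^-1` A.
have mW : measurable W.
  apply: measurableI; first exact: measurableX.
  by rewrite -[X in measurable X]setTI; exact: malpha.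
have W0 : (nu \x mu)%E W = 0%E.
  rewrite [LHS]product_measureC// /product_measure2.
  rewrite (ae_eq_integral (cst 0%E)) ?integral0//.
    exact: measurable_fun_ysection.
  apply: negligibleS nulls => x /= /not_implyP[_ /eqP h]; apply/eqP.
  suff <- : ysection W x = [set y | B y /\ A (alpha (y, x))] by [].
  by apply/seteqP; split => y; rewrite /ysection/= inE /W/=; [case=> -[]|case].
have /ae_eq_integral_abs : (\int[nu]_y `|(mu \o xsection W) y|)%E = 0%E.
  by rewrite -[RHS]W0; apply: eq_integral => y _; rewrite gee0_abs.
move=> /(_ measurableT (measurable_fun_xsection mu mW)) aeW.
apply/not_notP => muA; apply: nuB; apply/(negligibleP _ mB).
apply: negligibleS aeW => y By /= /(_ I) muW; apply: muA.
have [c sc] := salpha y By.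
apply: (scales_null_inv sc mA); rewrite -muW; congr (mu _).
by apply/seteqP; split => x; rewrite /xsection/= inE /W/=; [|case].
Qed.

Section enorm_theory.
Context {R : realType}.
Local Notation RR := (measurableTypeR R).
Variable k : nat.
Implicit Types x y : k.-tuple RR.

Lemma enorm_ge0 x : 0 <= enorm x. Proof. exact: sqrtr_ge0. Qed.

Lemma enorm_gt0 x i : tnth x i != 0 -> 0 < enorm x.
Proof.
move=> xi; rewrite sqrtr_gt0 (bigD1 i)//= ltr_pwDl//.
  by rewrite lt_def sqrf_eq0 xi sqr_ge0.
by apply: sumr_ge0 => *; exact: sqr_ge0.
Qed.

Lemma enorm_scale (c : R) x : 0 <= c ->
  enorm [tuple c * tnth x i | i < k] = c * enorm x.
Proof.
move=> c0; rewrite /enorm.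
under eq_bigr do rewrite tnth_mktuple exprMn.
by rewrite -mulr_sumr sqrtrM ?sqr_ge0// sqrtr_sqr ger0_norm.
Qed.

Lemma le_enorm x y : (forall i, 0 <= tnth x i <= tnth y i) -> enorm x <= enorm y.
Proof.
move=> xy; apply: ler_wsqrtr; apply: ler_sum => i _.
by have /andP[x0 h] := xy i; rewrite ler_sqr// nnegrE// (le_trans x0).
Qed.

(** At the origin both sides are the default vector of [normalize]. *)
Lemma normalize_scale (c : R) x : 0 < c ->
  normalize [tuple c * tnth x i | i < k] = normalize x.
Proof.
move=> c0; apply: eq_from_tnth => i.
rewrite !tnth_mktuple enorm_scale ?ltW// mulf_eq0 gt_eqF//=.
by case: eqP => // /eqP x0; field; rewrite x0 gt_eqF.
Qed.

End enorm_theory.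

Section unit_cube.
Context {R : realType}.
Local Notation RR := (measurableTypeR R).

(** The dilation factors of the orbit arguments: positive, so that each dilation scales the measure;
    at most 1, so that norms do not grow; and together of nonzero measure. *)
Definition unit_cube k : set (k.-tuple RR) :=
  [set y | forall i, 0 < tnth y i <= 1].

Lemma measurable_unit_cube k : measurable (@unit_cube k).
Proof.
rewrite (_ : @unit_cube k = [set y | forall i, [set` `]0, 1]] (tnth y i)]).
  exact: measurable_cube.
by apply/seteqP; split => x /= xi i; have := xi i; rewrite in_itv.
Qed.

Lemma unit_cube_neq0 k : lebesgue_real k (@unit_cube k) <> 0%E.
Proof.
have I1 : @lebesgue_measure R `]0, 1]%classic = 1%:E.
  by rewrite lebesgue_measure_itv/= lte_fin ltr01 sube0.
have := @tuple_measure_cube _ _ R lebesgue_measure k _ _ _ I1.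
rewrite expr1n (_ : [set _ | _] = @unit_cube k).
  by rewrite /lebesgue_real => -> // /eqP; rewrite eqe oner_eq0.
by apply/seteqP; split => x /= xi i; have := xi i; rewrite in_itv.
Qed.

End unit_cube.

Section blocks.
Variables (n l : nat) (k : 'I_l -> nat) (kn : (\sum_(j < l) k j)%N = n).

Definition block_of (i : 'I_n) : 'I_l := tagnat.sig1 (cast_ord (esym kn) i).

Lemma block_of_index j i : block_of (@block_index n l k kn j i) = j.
Proof. by rewrite /block_of /block_index cast_ordK tagnat.Rank1K. Qed.

Lemma block_index_inj j : injective (@block_index n l k kn j).
Proof.
move=> i i' /cast_ord_inj /tagnat.rank_inj /eqP.
by rewrite eq_Tagged => /eqP.
Qed.

Lemma block_indexP i : exists i', i = @block_index n l k kn (block_of i) i'.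
Proof.
exists (tagnat.sig2 (cast_ord (esym kn) i)).
by rewrite /block_index tagnat.sig2K cast_ordKV.
Qed.

End blocks.

Section null_transfer.
Context {R : realType}.
Local Notation RR := (measurableTypeR R).
Local Notation C := R[i].

Lemma measurable_set1C (w : C) : measurable [set w].
Proof.
rewrite /measurable /= /complex_measurable /=.
rewrite (_ : _ @^-1` _ = [set complex.Re w] `*` [set complex.Im w]).
  by apply: measurableX; exact: measurable_set1.
apply/seteqP; split; case: w => a b [x y]; rewrite /complex_of_pair/=.
  by case=> -> ->.
by case=> /= -> ->.
Qed.

Lemma lebesgueC_set1 (w : C) : lebesgueC [set w] = 0%E.
Proof.
rewrite /lebesgueC /pushforward.
rewrite (_ : _ @^-1` _ = [set complex.Re w] `*` [set complex.Im w]).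
  by rewrite product_measure1E//= lebesgue_measure_set1 mul0e.
apply/seteqP; split; case: w => a b [x y]; rewrite /complex_of_pair/=.
  by case=> -> ->.
by case=> /= -> ->.
Qed.

Lemma lebesgueC_setT_neq0 : @lebesgueC R setT <> 0%E.
Proof.
rewrite /lebesgueC /pushforward preimage_setT -setXTT product_measure1E//=.
have -> : @lebesgue_measure R setT = +oo%E by rewrite -set_itvNyy lebesgue_measure_itv.
by rewrite mulyy.
Qed.

Section coordinate_hyperplanes.
Variable n : nat.
Local Notation mu := (@lebesgue_complex R n).

(** Translating coordinate [i] by y, the orbit of z meets the hyperplane only at y = - z_i, and a
    point of C is null. *)
Lemma tnth_eq0_negligible (i : 'I_n) : mu.-negligible [set z | tnth z i = 0].
Proof.
have m0 : measurable [set z : n.-tuple C | tnth z i = 0].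
  rewrite (_ : [set _ | _] = (fun z => tnth z i) @^-1` [set 0])//.
  rewrite -[X in measurable X]setTI; apply: measurable_tnth => //.
  exact: measurable_set1C.
apply/negligibleP => //.
apply: (@null_of_null_orbits _ _ _ _ _ mu lebesgueC
  (fun x => tuple_set x.2 i (tnth x.2 i + x.1)) _ setT) => //.
- apply: measurable_tuple_set => //; apply: measurable_funCD => //.
  exact: (measurableT_comp (measurable_tnth i) measurable_snd).
- exact: lebesgueC_setT_neq0.
- move=> y _; exists 1; apply: scales_tuple_set.
    by apply: measurable_funCD; [exact: measurable_tnth|exact: measurable_cst].
  move=> z; have := scales_lebesgueCD y.
  by under [X in _ -> scales _ X _]eq_fun do rewrite tnth_mktuple eqxx.
- rewrite (_ : [set _ | _] = set0); first exact: negligible_set0.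
  apply/seteqP; split=> // z /=; apply.
  rewrite -(lebesgueC_set1 (- tnth z i)); congr (lebesgueC _).
  apply/seteqP; split=> w /=; rewrite tnth_mktuple eqxx.
    by case=> _ /eqP; rewrite addrC addr_eq0 => /eqP.
  by move=> ->; rewrite subrr.
Qed.

Lemma some_tnth_eq0_negligible :
  mu.-negligible [set z | exists i, tnth z i = 0].
Proof.
have : mu.-negligible (\big[setU/set0]_(i < n) [set z | tnth z i = 0]).
  elim/big_ind: _ => //; first exact: negligible_set0.
    by move=> *; exact: negligibleU.
  by move=> i _; exact: tnth_eq0_negligible.
by apply: negligibleS => z /= [i zi]; rewrite (bigD1 i)//=; left.
Qed.

End coordinate_hyperplanes.


Section block_null.
Variables (n l : nat) (k : 'I_l -> nat) (k_gt0 : forall j, (0 < k j)%N)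
  (kn : (\sum_(j < l) k j)%N = n).
Local Notation mu := (@lebesgue_complex R n).

Lemma measurable_moduli_block j :
  measurable_fun setT (fun z : n.-tuple C => moduli (block kn z j)).
Proof.
apply/measurable_fun_tnthP => i.
apply: (eq_measurable_fun (fun z : n.-tuple C => normc (tnth z (block_index kn i)) : RR)).
  by move=> z _ /=; rewrite !tnth_mktuple.
by apply: measurable_normc; exact: measurable_tnth.
Qed.

Lemma measurable_radii :
  measurable_fun setT (fun z : n.-tuple C => radii kn z).
Proof.
apply/measurable_fun_tnthP => j.
apply: (eq_measurable_fun (fun z => enorm (moduli (block kn z j)) : RR)).
  by move=> z _ /=; rewrite tnth_mktuple.
exact: (measurableT_comp (@measurable_enorm R (k j)) (@measurable_moduli_block j)).
Qed.

Lemma measurable_direction j :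
  measurable_fun setT (fun z : n.-tuple C => normalize (moduli (block kn z j))).
Proof.
exact: (measurableT_comp (@measurable_normalize R (k j)) (@measurable_moduli_block j)).
Qed.

Lemma normc_scale (c : R) (w : C) : 0 <= c -> normc (c%:C * w) = c * normc w.
Proof.
by move=> c0; rewrite normcM; congr (_ * _); rewrite /normc/= expr0n/= addr0 sqrtr_sqr ger0_norm.
Qed.

Lemma normc_gt0 (w : C) : w <> 0 -> 0 < normc w.
Proof.
move=> w0; rewrite lt_def; case: w w0 => a b w0; rewrite sqrtr_ge0 andbT.
by apply/eqP => /eq0_normc.
Qed.

Lemma moduli_block_gt0 (z : n.-tuple C) j i :
  ~ (exists i, tnth z i = 0) -> 0 < tnth (moduli (block kn z j)) i.
Proof.
by move=> z0; rewrite !tnth_mktuple; apply: normc_gt0 => zi; apply: z0; eexists; exact: zi.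
Qed.

(** The [pick] inverts [block_index]; the default 1 leaves the other blocks fixed. *)
Let index_scale j (y : (k j).-tuple RR) (i : 'I_n) : R :=
  if [pick i' | block_index kn i' == i] is Some i' then tnth y i' else 1.

Let index_scaleE j (y : (k j).-tuple RR) i :
  index_scale y (block_index kn i) = tnth y i.
Proof.
rewrite /index_scale; case: pickP => [i' /eqP /block_index_inj -> //|/(_ i)].
by rewrite eqxx.
Qed.

Let index_scale_gt0 j (y : (k j).-tuple RR) i : unit_cube y -> 0 < index_scale y i.
Proof.
by move=> y0; rewrite /index_scale; case: pickP => // i' _; case/andP: (y0 i').
Qed.

Lemma measurable_scaled_tuple d (Y : measurableType d) (c : Y -> 'I_n -> R) :
  (forall i, measurable_fun setT (fun y => c y i : RR)) ->
  measurable_fun setT (fun x : Y * n.-tuple C =>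
    [tuple (c x.1 i)%:C * tnth x.2 i | i < n]).
Proof.
move=> mc; apply/measurable_fun_tnthP => i.
apply: (eq_measurable_fun (fun x : Y * n.-tuple C => (c x.1 i)%:C * tnth x.2 i)).
  by move=> z _ /=; rewrite tnth_mktuple.
apply: measurable_funCM.
  apply: measurable_funC_real.
  exact: (measurableT_comp (mc i) measurable_fst).
exact: (measurableT_comp (measurable_tnth i) measurable_snd).
Qed.

(** Dilate the coordinates of block [j] independently. If no coordinate of z vanishes, the moduli of
    the block depend on the factors through an invertible diagonal map, so the factors leading into
    [M] lie in the preimage of the cone [K] over [M]. This cone is null by the definition of surface
    measure. *)
Lemma direction_negligible j (M : set ((k j).-tuple RR)) :
  measurable M -> sphere_measure M = 0%E ->
  mu.-negligible [set z | M (normalize (moduli (block kn z j)))].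
Proof.
move=> mM M0.
pose K : set ((k j).-tuple RR) := [set x | punctured_ball x /\ M (normalize x)].
have mK : measurable K.
  apply: measurableI; first exact: measurable_punctured_ball.
  by rewrite -[X in measurable X]setTI; exact: measurable_normalize.
have K0 : lebesgue_real (k j) K = 0%E.
  move: M0; rewrite /sphere_measure => /eqP; rewrite mule_eq0 eqe pnatr_eq0.
  by rewrite gtn_eqF//= => /eqP.
have mA : measurable [set z : n.-tuple C | M (normalize (moduli (block kn z j)))].
  by rewrite -[X in measurable X]setTI; apply: measurable_direction.
apply/negligibleP => //.
apply: (@null_of_null_orbits _ _ _ _ _ mu (lebesgue_real (k j))
  (fun x => [tuple (index_scale x.1 i)%:C * tnth x.2 i | i < n]) _
  (@unit_cube R (k j))) => //.
- apply: measurable_scaled_tuple => i; rewrite /index_scale.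
  by case: pickP => [i' _|_]; [exact: measurable_tnth|exact: measurable_cst].
- exact: measurable_unit_cube.
- exact: unit_cube_neq0.
- move=> y y0; eexists.
  apply: (scales_tuple_map (f := fun i w => (index_scale y i)%:C * w)) => i.
  by apply: scales_lebesgueCM; exact: index_scale_gt0.
apply: negligibleS (some_tnth_eq0_negligible n) => z /= h.
apply: contrapT => z0; apply: h.
set x := moduli (block kn z j).
have x0 i : 0 < tnth x i by exact: moduli_block_gt0.
(* [K] contains only points of norm at most 1. Scaling by [e] brings all the moduli x_i y_i with y_i
   <= 1 into this ball and keeps their direction. *)
pose e := (1 + enorm x)^-1.
have e0 : 0 < e by rewrite invr_gt0 ltr_pwDl// enorm_ge0.
have [_ mS sS] : scales (lebesgue_real (k j))
    (fun y => [tuple (e * tnth x i) * tnth y i | i < k j])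
    (\prod_(i < k j) (e * tnth x i)^-1).
  apply: (scales_tuple_map (f := fun i (w : RR) => (e * tnth x i * w : RR))
    (c := fun i => (e * tnth x i)^-1)) => i.
  by apply: scales_lebesgueM; exact: mulr_gt0.
have := sS K mK; rewrite K0 mule0 => S0.
apply: (subset_measure0 _ _ _ S0).
- apply: measurableI; first exact: measurable_unit_cube.
  rewrite -[X in measurable X]setTI.
  apply: (measurableT_comp (measurableT_comp (@measurable_direction j)
    (@measurable_scaled_tuple _ _ (fun y => index_scale y) _)) (pair2_measurable z)) => //.
  move=> i; rewrite /index_scale.
  by case: pickP => [i' _|_]; [exact: measurable_tnth|exact: measurable_cst].
- by rewrite -[X in measurable X]setTI; exact: mS.
move=> y [y0]; rewrite /K /=.
pose w : (k j).-tuple RR := [tuple tnth x i * tnth y i | i < k j].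
have -> : moduli (block kn [tuple (index_scale y i)%:C * tnth z i | i < n] j) = w.
  apply: eq_from_tnth => i; rewrite !tnth_mktuple index_scaleE.
  rewrite normc_scale; last by case/andP: (y0 i) => /ltW.
  by rewrite mulrC.
have -> : [tuple e * tnth x i * tnth y i | i < k j] =
    [tuple e * tnth w i | i < k j].
  by apply: eq_from_tnth => i; rewrite !tnth_mktuple mulrA.
move=> Mw; rewrite normalize_scale//; split=> //.
rewrite /punctured_ball /= enorm_scale; last exact: ltW.
apply/andP; split.
  apply: mulr_gt0 => //; apply: (@enorm_gt0 _ _ _ (Ordinal (k_gt0 j))).
  rewrite tnth_mktuple gt_eqF// mulr_gt0//.
  by case/andP: (y0 (Ordinal (k_gt0 j))).
rewrite /e mulrC ler_pdivrMr ?ltr_pwDl ?enorm_ge0// mul1r.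
rewrite (@le_trans _ _ (enorm x)) ?lerDr// le_enorm// => i.
rewrite tnth_mktuple; case/andP: (y0 i) => yi yi1.
apply/andP; split; first by apply: mulr_ge0; exact: ltW.
by rewrite ler_piMr//; exact: ltW.
Qed.

Let block_scale (y : l.-tuple RR) (i : 'I_n) : R := tnth y (block_of kn i).

(** Dilating each block as a whole multiplies the radii by the factors and keeps the directions. The
    factors leading into [N] then form the preimage, under a diagonal map, of the slice of [N] at
    the direction of z. By Tonelli that slice is null unless the direction lies in a null set [M] of
    the sphere, and [direction_negligible] discards those z. *)
Lemma polar_negligible j (N : set (l.-tuple RR * (k j).-tuple RR)) :
  measurable N -> (lebesgue_real l \x @sphere_measure R (k j))%E N = 0%E ->
  mu.-negligible [set z | N (radii kn z, normalize (moduli (block kn z j)))].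
Proof.
move=> mN; rewrite product_measureC// /product_measure2 => N0.
have mphi : measurable_fun setT (fun z : n.-tuple C =>
    (radii kn z, normalize (moduli (block kn z j)))).
  by apply: measurable_fun_pair; [exact: measurable_radii|exact: measurable_direction].
have mNy := measurable_fun_ysection (lebesgue_real l) mN.
pose M := [set w | (lebesgue_real l \o ysection N) w != 0%E].
have mM : measurable M by rewrite -[X in measurable X]setTI; exact: emeasurable_neq.
have M0 : sphere_measure M = 0%E.
  apply/(negligibleP _ mM).
  have /ae_eq_integral_abs :
      (\int[@sphere_measure R (k j)]_w `|(lebesgue_real l \o ysection N) w|)%E = 0%E.
    by rewrite -[RHS]N0; apply: eq_integral => w _; rewrite gee0_abs.
  move=> /(_ measurableT mNy); apply: negligibleS => w /= /eqP w0.
  by move=> /(_ I).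
have mA : measurable [set z | N (radii kn z, normalize (moduli (block kn z j)))].
  by rewrite -[X in measurable X]setTI; exact: mphi.
have mbs i : measurable_fun setT (fun y : l.-tuple RR => block_scale y i : RR).
  exact: measurable_tnth.
apply/negligibleP => //.
apply: (@null_of_null_orbits _ _ _ _ _ mu (lebesgue_real l)
  (fun x => [tuple (block_scale x.1 i)%:C * tnth x.2 i | i < n]) _
  (@unit_cube R l)) => //.
- exact: measurable_scaled_tuple.
- exact: measurable_unit_cube.
- exact: unit_cube_neq0.
- move=> y y0; eexists.
  apply: (scales_tuple_map (f := fun i w => (block_scale y i)%:C * w)) => i.
  by apply: scales_lebesgueCM; case/andP: (y0 (block_of kn i)).
apply: negligibleS (negligibleU (some_tnth_eq0_negligible n)
  (direction_negligible mM M0)) => z /= h.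
apply: contrapT => /not_orP[z0 /negP/negPn/eqP ND]; apply: h.
have r0 i : 0 < tnth (radii kn z) i.
  rewrite tnth_mktuple (@enorm_gt0 _ _ _ (Ordinal (k_gt0 i)))//.
  by rewrite gt_eqF// moduli_block_gt0.
have [_ mS sS] : scales (lebesgue_real l)
    (fun y => [tuple tnth (radii kn z) i * tnth y i | i < l])
    (\prod_(i < l) (tnth (radii kn z) i)^-1).
  apply: (scales_tuple_map (f := fun i (w : RR) => (tnth (radii kn z) i * w : RR))
    (c := fun i => (tnth (radii kn z) i)^-1)) => i.
  exact: scales_lebesgueM.
have := sS _ (measurable_ysection (normalize (moduli (block kn z j))) mN).
rewrite [X in (_ * X)%E]ND mule0 => S0.
apply: (subset_measure0 _ _ _ S0).
- apply: measurableI; first exact: measurable_unit_cube.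
  rewrite -[X in measurable X]setTI.
  exact: (measurableT_comp (measurableT_comp mphi
    (@measurable_scaled_tuple _ _ block_scale mbs)) (pair2_measurable z)).
- rewrite -[X in measurable X]setTI; apply: mS => //.
  exact: measurable_ysection.
move=> y [y0]; rewrite /ysection /= inE.
have mE i : moduli (block kn [tuple (block_scale y i)%:C * tnth z i | i < n] i) =
    [tuple tnth y i * tnth (moduli (block kn z i)) i' | i' < k i].
  apply: eq_from_tnth => i'; rewrite !tnth_mktuple /block_scale block_of_index.
  by rewrite normc_scale//; case/andP: (y0 i) => /ltW.
rewrite mE normalize_scale; last by case/andP: (y0 j).
rewrite (_ : radii kn _ = [tuple tnth (radii kn z) i * tnth y i | i < l])//.
apply: eq_from_tnth => i; rewrite !tnth_mktuple mE enorm_scale 1?mulrC//.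
by case/andP: (y0 i) => /ltW.
Qed.

(** The cylinder over [N] in the direction variable of any block [j] is null. *)
Lemma radii_negligible (N : set (l.-tuple RR)) (j : 'I_l) :
  measurable N -> lebesgue_real l N = 0%E ->
  mu.-negligible [set z | N (radii kn z)].
Proof.
move=> mN N0; have N0' :
    (lebesgue_real l \x @sphere_measure R (k j))%E (N `*` setT) = 0%E.
  by rewrite product_measure1E//= [X in (X * _)%E]N0 mul0e.
have := polar_negligible (measurableX mN measurableT) N0'.
by apply: negligibleS => z /= Nz; split.
Qed.

End block_null.

End null_transfer.

(** * Integrability against the Bergman weight *)

Section complex_integral_theory.
Context d (T : measurableType d) (R : realType).
Variable mu : {measure set T -> \bar R}.
Local Notation C := R[i].
Implicit Types F G : T -> C.

(** [complex_integral] has a value for every function, so its linearity has to be guarded by this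
    predicate. *)
Definition cintegrable F : Prop :=
  mu.-integrable setT (EFin \o (fun x => complex.Re (F x))) /\
  mu.-integrable setT (EFin \o (fun x => complex.Im (F x))).

Lemma cintegrable0 : cintegrable (fun=> 0).
Proof. by split; exact: integrable0. Qed.

Lemma cintegrableD F G : cintegrable F -> cintegrable G ->
  cintegrable (fun x => F x + G x).
Proof.
move=> [Fr Fi] [Gr Gi]; split.
  by apply: (eq_integrable measurableT _ _ _ (integrableD measurableT Fr Gr)) => // x _ /=; rewrite raddfD.
by apply: (eq_integrable measurableT _ _ _ (integrableD measurableT Fi Gi)) => // x _ /=; rewrite raddfD.
Qed.

Lemma cintegralD F G : cintegrable F -> cintegrable G ->
  complex_integral mu (fun x => F x + G x) =
  complex_integral mu F + complex_integral mu G.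
Proof.
move=> [Fr Fi] [Gr Gi]; rewrite /complex_integral.
under eq_Rintegral do rewrite raddfD.
under [X in _ +i* X]eq_Rintegral do rewrite raddfD.
by rewrite /= !RintegralD.
Qed.

Lemma cintegrableZ (c : C) F : cintegrable F -> cintegrable (fun x => c * F x).
Proof.
move=> [Fr Fi]; split.
  apply: (eq_integrable measurableT _ _ _ (integrableB measurableT (integrableZl measurableT (complex.Re c) Fr)
    (integrableZl measurableT (complex.Im c) Fi))) => // x _ /=.
  by rewrite Re_mulc -!EFinM -EFinB.
apply: (eq_integrable measurableT _ _ _ (integrableD measurableT (integrableZl measurableT (complex.Re c) Fi)
    (integrableZl measurableT (complex.Im c) Fr))) => // x _ /=.
by rewrite Im_mulc -!EFinM -EFinD.
Qed.

Lemma cintegralZ (c : C) F : cintegrable F ->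
  complex_integral mu (fun x => c * F x) = c * complex_integral mu F.
Proof.
move=> [Fr Fi]; rewrite /complex_integral.
have Z (r : R) (f : T -> R) : mu.-integrable setT (EFin \o f) ->
    mu.-integrable setT (EFin \o (fun x => r * f x)).
  move=> fi; apply: (eq_integrable measurableT _ _ _ (integrableZl measurableT r fi)) => // x _ /=.
under eq_Rintegral do rewrite Re_mulc.
under [X in _ +i* X]eq_Rintegral do rewrite Im_mulc.
rewrite RintegralB ?RintegralD//; try exact: Z.
rewrite !RintegralZl//.
by case: c => a b; simpc.
Qed.

Lemma cintegrable_sum (I : Type) (s : seq I) (P : pred I) (F : I -> T -> C) :
  (forall i, P i -> cintegrable (F i)) ->
  cintegrable (fun x => \sum_(i <- s | P i) F i x).
Proof.
move=> Fi; elim: s => [|i s IH].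
  rewrite (_ : (fun _ => _) = fun=> 0); first exact: cintegrable0.
  by apply/funext => x; rewrite big_nil.
have [Pi|nPi] := boolP (P i).
  rewrite (_ : (fun _ => _) = (fun x => F i x + \sum_(j <- s | P j) F j x)).
    by apply: cintegrableD => //; exact: Fi.
  by apply/funext => x; rewrite big_cons Pi.
rewrite (_ : (fun _ => _) = (fun x => \sum_(j <- s | P j) F j x))//.
by apply/funext => x; rewrite big_cons (negbTE nPi).
Qed.

Lemma cintegral0 : complex_integral mu (fun=> 0) = 0.
Proof.
rewrite -[RHS](mul0r (complex_integral mu (fun=> 0))) -(cintegralZ 0 cintegrable0).
by congr complex_integral; apply/funext => x; rewrite mul0r.
Qed.

Lemma cintegral_sum (I : Type) (s : seq I) (P : pred I) (F : I -> T -> C) :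
  (forall i, P i -> cintegrable (F i)) ->
  complex_integral mu (fun x => \sum_(i <- s | P i) F i x) =
  \sum_(i <- s | P i) complex_integral mu (F i).
Proof.
move=> Fi; elim: s => [|i s IH].
  rewrite big_nil -[RHS]cintegral0; congr complex_integral.
  by apply/funext => x; rewrite big_nil.
rewrite big_cons -IH; case: ifPn => Pi.
  rewrite -cintegralD; [|exact: Fi|exact: cintegrable_sum].
  by congr complex_integral; apply/funext => x; rewrite big_cons Pi.
by congr complex_integral; apply/funext => x; rewrite big_cons (negbTE Pi).
Qed.

Lemma normc_sqrt (w : C) :
  normc w = Num.sqrt (complex.Re w ^+ 2 + complex.Im w ^+ 2).
Proof. by case: w. Qed.

Lemma normc_ge0 (w : C) : 0 <= normc w.
Proof. by rewrite normc_sqrt sqrtr_ge0. Qed.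

Lemma Re_le_normc (w : C) : `|complex.Re w| <= normc w.
Proof. by rewrite normc_sqrt -sqrtr_sqr ler_wsqrtr// lerDl sqr_ge0. Qed.

Lemma Im_le_normc (w : C) : `|complex.Im w| <= normc w.
Proof. by rewrite normc_sqrt -sqrtr_sqr ler_wsqrtr// lerDr sqr_ge0. Qed.

(** Domination almost everywhere, because symbols are bounded only up to a null set. *)
Lemma cintegrable_le F (G : T -> R) : measurable_fun setT F ->
  mu.-integrable setT (EFin \o G) ->
  {ae mu, forall x, normc (F x) <= G x} -> cintegrable F.
Proof.
move=> /measurable_complexP[mr mi] /integrableP[mG iG] FG.
have key (f : T -> measurableTypeR R) : measurable_fun setT f ->
    (forall x, `|f x| <= normc (F x)) -> mu.-integrable setT (EFin \o f).
  move=> mf fF; apply/integrableP; split; first exact/measurable_EFinP.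
  apply: le_lt_trans iG; apply: ae_ge0_le_integral => //.
  - by apply: measurableT_comp => //; exact/measurable_EFinP.
  - exact: measurableT_comp.
  - apply: filterS FG => x /= FGx _; rewrite lee_fin.
    by rewrite (le_trans (fF x))// (le_trans FGx)// ler_norm.
split; apply: key => // x; first exact: Re_le_normc.
exact: Im_le_normc.
Qed.

Lemma cintegral_comp (g : T -> T) F : scales mu g 1 ->
  measurable_fun setT F -> cintegrable F ->
  cintegrable (F \o g) /\
  complex_integral mu (F \o g) = complex_integral mu F.
Proof.
move=> [_ mg sg] /measurable_complexP[mr mi] [Fr Fi].
(* With factor 1, [scales] says that the pushforward of [mu] along [g] is [mu] itself. *)
have pmu A : measurable A -> A `<=` setT -> pushforward mu g A = mu A.
  by move=> mA _; rewrite /pushforward sg// mul1e.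
have key (f : T -> measurableTypeR R) : measurable_fun setT f ->
    mu.-integrable setT (EFin \o f) -> mu.-integrable setT (EFin \o (f \o g)) /\
    \int[mu]_x f (g x) = \int[mu]_x f x.
  move=> mf /integrableP[mf' fi].
  have fgi : mu.-integrable setT (EFin \o (f \o g)).
    apply/integrableP; split.
      by apply/measurable_EFinP; exact: measurableT_comp.
    apply: le_lt_trans fi; rewrite -[leRHS](eq_measure_integral _ pmu).
    rewrite [leRHS]ge0_integral_pushforward//.
    by apply: measurableT_comp.
  split=> //; rewrite /Rintegral; congr fine.
  by rewrite -[RHS](eq_measure_integral _ pmu) [RHS]integral_pushforward.
have [ri re] := key _ mr Fr; have [ii ie] := key _ mi Fi.
by split => //; rewrite /complex_integral re ie.
Qed.

End complex_integral_theory.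

(** * Integrability of the weight by a geometric series *)

Section weight_integrability.
Context {R : realType}.
Local Notation RR := (measurableTypeR R).
Local Notation C := R[i].

Definition rho n (z : n.-tuple C) : R := 1 + \sum_(i < n) normc (tnth z i) ^+ 2.

Lemma rho_ge1 n (z : n.-tuple C) : 1 <= rho z.
Proof. by rewrite lerDl sumr_ge0// => i _; exact: sqr_ge0. Qed.

Lemma rho_gt0 n (z : n.-tuple C) : 0 < rho z.
Proof. exact: lt_le_trans ltr01 (rho_ge1 z). Qed.

Lemma normc_lt_rho n (z : n.-tuple C) i : normc (tnth z i) ^+ 2 < rho z.
Proof.
rewrite /rho (bigD1 i)//= addrCA ltrDl ltr_pwDl// sumr_ge0// => j _.
exact: sqr_ge0.
Qed.

Lemma measurable_rho n : measurable_fun setT (fun z : n.-tuple C => rho z : RR).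
Proof.
apply: measurable_funD => //; apply: measurable_sum => i.
by apply: measurable_funX; apply: measurable_normc; exact: measurable_tnth.
Qed.

Definition square (r : R) : set C :=
  [set w | [set` `]- r, r]] (complex.Re w) /\ [set` `]- r, r]] (complex.Im w)].

Let square_preimage (r : R) : complex_of_pair @^-1` (square r) =
  ([set` `]- r, r]] : set RR) `*` [set` `]- r, r]].
Proof. by apply/seteqP; split=> -[x y]. Qed.

Lemma measurable_square (r : R) : measurable (square r).
Proof.
rewrite /measurable /= /complex_measurable /= square_preimage.
exact: measurableX.
Qed.

Lemma lebesgueC_square (r : R) : 0 < r -> lebesgueC (square r) = (4 * r ^+ 2)%:E.
Proof.
move=> r0; rewrite /lebesgueC /pushforward square_preimage product_measure1E//=.
rewrite lebesgue_measure_itv/= lte_fin ifT; last by lra.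
by rewrite -EFinB -EFinM; congr (_%:E); ring.
Qed.

Definition polysquare n (r : R) : set (n.-tuple C) :=
  [set z | forall i, square r (tnth z i)].

Lemma measurable_polysquare n (r : R) : measurable (@polysquare n r).
Proof. by apply: measurable_cube; exact: measurable_square. Qed.

Lemma lebesgue_complex_polysquare n (r : R) : 0 < r ->
  lebesgue_complex n (@polysquare n r) = ((4 * r ^+ 2) ^+ n)%:E.
Proof.
move=> r0; apply: tuple_measure_cube (lebesgueC_square r0).
exact: measurable_square.
Qed.

(** Take the least power of 4 above [rho z]; for j = 0 the second inequality is [rho_ge1]. *)
Let dyadic_scale n (z : n.-tuple C) : exists j : nat, rho z <= 4 ^+ j <= 4 * rho z.
Proof.
have [N zN] : exists N : nat, rho z <= 4 ^+ N.
  exists (Num.truncn (rho z)).+1.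
  apply: (@le_trans _ _ (Num.truncn (rho z)).+1%:R).
    exact/ltW/truncnS_gt.
  by rewrite -natrX ler_nat ltnW// ltn_expl.
elim: N zN => [|N IH] zN.
  by exists 0; rewrite zN expr0; have := rho_ge1 z; lra.
have [/IH//|zN'] := leP (rho z) (4 ^+ N).
by exists N.+1; rewrite zN exprS ler_pM2l ?ltW.
Qed.

Let sqr2 : 2 ^+ 2 = 4 :> R. Proof. by rewrite -natrX. Qed.

Let polysquare_rho n (z : n.-tuple C) j : rho z <= 4 ^+ j -> @polysquare n (2 ^+ j) z.
Proof.
move=> zj i; suff h : normc (tnth z i) < 2 ^+ j.
  split; rewrite /= in_itv/=.
    by have := Re_le_normc (tnth z i); rewrite ler_norml; lra.
  by have := Im_le_normc (tnth z i); rewrite ler_norml; lra.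
rewrite -(@ltr_pXn2r _ 2)// ?nnegrE ?normc_ge0 ?exprn_ge0//.
by rewrite (lt_le_trans (normc_lt_rho z i))// (le_trans zj)// -exprM mulnC exprM sqr2.
Qed.

(** The value (4 / 4^j)^(n+1) dominates rho^-(n+1) as soon as 4^j <= 4 rho. The polysquare of
    half-side 2^j has volume (4 * 4^j)^n, so the integral is 4^(2n+1) / 4^j, which is summable in
    j. *)
Let shell n (j : nat) (z : n.-tuple C) : R :=
  (4 ^+ n.+1 * (4 ^+ j) ^- n.+1) * \1_(@polysquare n (2 ^+ j)) z.

Let shell_ge0 n j (z : n.-tuple C) : 0 <= shell j z.
Proof.
apply: mulr_ge0; last by rewrite indicE ler0n.
by rewrite mulr_ge0 ?invr_ge0 ?exprn_ge0// exprn_ge0.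
Qed.

Let measurable_shell n j : measurable_fun setT (fun z : n.-tuple C => shell j z : RR).
Proof.
by apply: measurable_funM => //; apply: measurable_indic; exact: measurable_polysquare.
Qed.

Let rho_le_shell n (z : n.-tuple C) : exists j, (rho z ^+ n.+1)^-1 <= shell j z.
Proof.
have [j /andP[zj jz]] := dyadic_scale z; exists j.
rewrite /shell indicE mem_set ?mulr1; last exact: polysquare_rho.
rewrite -[leLHS]mul1r ler_pdivlMr ?exprn_gt0// mulrAC.
rewrite ler_pdivrMr ?exprn_gt0 ?rho_gt0// mul1r -exprMn.
by rewrite lerXn2r// nnegrE ?exprn_ge0// mulr_ge0// ltW// rho_gt0.
Qed.

Let integral_shell n j :
  (\int[lebesgue_complex n]_z (shell j z)%:E)%E = (4 ^+ (n + n.+1) / 4 ^+ j)%:E.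
Proof.
rewrite (_ : (fun z => (shell j z)%:E) = fun z => ((4 ^+ n.+1 * (4 ^+ j) ^- n.+1)%:E *
   (\1_(@polysquare n (2 ^+ j)) z)%:E)%E) //.
rewrite ge0_integralZl//; last first.
  by apply/measurable_EFinP; apply: measurable_indic; exact: measurable_polysquare.
rewrite integral_indic//; last exact: measurable_polysquare.
rewrite setIT [X in (_ * X)%E]lebesgue_complex_polysquare ?exprn_gt0// -EFinM; congr (_%:E).
have -> : (2 ^+ j) ^+ 2 = 4 ^+ j :> R by rewrite -exprM (mulnC j) exprM sqr2.
rewrite (exprS (4 ^+ j)) exprMn exprD.
by field; rewrite !expf_neq0.
Qed.

(** Every value is below one of the terms [shell j z], hence below their sum, which is integrated
    term by term. *)
Lemma rho_inv_integrable n :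
  (lebesgue_complex n).-integrable setT
    (EFin \o (fun z : n.-tuple C => (rho z ^+ n.+1)^-1)).
Proof.
have mf : measurable_fun setT (fun z : n.-tuple C => (rho z ^+ n.+1)^-1 : RR).
  apply: measurable_funR_inv => [z|]; first by rewrite exprn_ge0// ltW// rho_gt0.
  by apply: measurable_funX; exact: measurable_rho.
apply/integrableP; split; first exact/measurable_EFinP.
apply: (@le_lt_trans _ _ (\int[lebesgue_complex n]_z \sum_(j <oo) (shell j z)%:E)%E).
  apply: ge0_le_integral => //.
  - by apply: measurableT_comp => //; exact/measurable_EFinP.
  - apply: (@ge0_emeasurable_sum _ _ _ setT
      (fun j (z : n.-tuple C) => (shell j z)%:E) xpredT) => [j z _ _|j _].
      by rewrite lee_fin.
    by apply/measurable_EFinP; exact: measurable_shell.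
  move=> z _ /=; have [j zj] := rho_le_shell z.
  rewrite ger0_norm; last by rewrite invr_ge0 exprn_ge0// ltW// rho_gt0.
  apply: (@le_trans _ _ (\sum_(0 <= i < j.+1) (shell i z)%:E)%E).
    rewrite big_nat_recr//= (@le_trans _ _ (shell j z)%:E)%E ?lee_fin//.
    by rewrite leeDr// sume_ge0// => i _; rewrite lee_fin.
  by apply: nneseries_lim_ge => i _ _; rewrite lee_fin.
rewrite integral_nneseries//; last 2 first.
- by move=> j; apply/measurable_EFinP; exact: measurable_shell.
- by move=> j z _; rewrite lee_fin.
under eq_eseriesr do rewrite integral_shell.
apply: (@le_lt_trans _ _ (4 ^+ (n + n.+1) * 2)%:E); last by rewrite ltry.
apply: lime_le.
  by apply: is_cvg_nneseries => j _ _; rewrite lee_fin divr_ge0 ?exprn_ge0.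
apply: nearW => N; rewrite sumEFin lee_fin -mulr_sumr ler_pM2l ?exprn_gt0//.
(* The negative remainder makes the bound strong enough for induction on N. *)
suff : \sum_(0 <= i < N) (4 ^+ i)^-1 <= 2 - 2 * (4 ^+ N)^-1 :> R.
  by move=> /le_trans; apply; rewrite gerBl mulr_ge0// invr_ge0 exprn_ge0.
elim: N => [|N IH]; first by rewrite big_geq// expr0 invr1; lra.
rewrite big_nat_recr//= exprS invfM.
have : 0 <= (4 ^+ N)^-1 :> R by rewrite invr_ge0 exprn_ge0.
by move: IH; lra.
Qed.

End weight_integrability.

(** * Monomials and polynomials of bounded degree *)

Section monomials.
Context {R : realType}.
Local Notation RR := (measurableTypeR R).
Local Notation C := R[i].
Variable n : nat.
Implicit Types (e : multinom n) (z : n.-tuple C) (f g : n.-tuple C -> C).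

Definition monomial e z : C := \prod_(i < n) tnth z i ^+ e i.

Lemma measurable_monomial e : measurable_fun setT (monomial e).
Proof.
apply: measurable_funC_prod => i; apply: measurable_funCX.
exact: measurable_tnth.
Qed.

(** [bmultinom n m.+1] is the finite type of multi-indices of degree less than m + 1, so it indexes
    the monomial basis. *)
Lemma bergman_spaceP (m : nat) f : bergman_space m f <->
  exists c : bmultinom n m.+1 -> C,
    f = fun z => \sum_b c b * monomial (bmnm b) z.
Proof.
split=> [[q qm ->]|[c ->]].
  exists (fun b => mcoeff (bmnm b) q); apply/funext => z.
  rewrite {1}(@mpolywE _ _ m.+1 q); last first.
    by rewrite msizeE; apply/bigmax_leqP_seq => e /qm.
  by rewrite raddf_sum; apply: eq_bigr => e _; rewrite /= mevalZ mevalX.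
exists (\sum_b c b *: mpolyX _ (bmnm b)).
  move=> e; rewrite mcoeff_msupp raddf_sum /= leqNgt; apply: contra => em.
  apply/eqP/big1 => e' _; rewrite mcoeffZ mcoeffX.
  case: eqP => [ee'|_]; last by rewrite mulr0.
  by move: (bmdeg e'); rewrite ee' ltnS leqNgt em.
apply/funext => z; rewrite raddf_sum; apply: eq_bigr => e _.
by rewrite /= mevalZ mevalX.
Qed.

Lemma bergman_space_monomial (m : nat) e : (mdeg e <= m)%N ->
  bergman_space m (monomial e).
Proof.
move=> em; exists (mpolyX _ e).
  by move=> e'; rewrite msuppX inE => /eqP ->.
by apply/funext => z; rewrite mevalX.
Qed.

Lemma bergman_spaceD (m : nat) f g : bergman_space m f -> bergman_space m g ->
  bergman_space m (fun z => f z + g z).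
Proof.
move=> /bergman_spaceP[c ->] /bergman_spaceP[c' ->]; apply/bergman_spaceP.
exists (fun b => c b + c' b); apply/funext => z.
by rewrite -big_split; apply: eq_bigr => e _; rewrite mulrDl.
Qed.

Lemma bergman_spaceM (m m' : nat) f g :
  bergman_space m f -> bergman_space m' g ->
  bergman_space (m + m') (fun z => f z * g z).
Proof.
move=> [q qm ->] [q' qm' ->]; exists (q * q'); last first.
  by apply/funext => z; rewrite mevalM.
move=> e /msuppM_le /allpairsP[[e1 e2] /= [e1q e2q ->]].
by rewrite mdegD leq_add// ?qm ?qm'.
Qed.

Lemma bergman_space_cst (m : nat) (c : C) : bergman_space m (fun _ : n.-tuple C => c).
Proof.
exists (mpolyC n c); last by apply/funext => z; rewrite mevalC.
by move=> e; rewrite msuppC; case: eqP => // _; rewrite inE => /eqP ->; rewrite mdeg0.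
Qed.

Lemma bergman_space_coordinate (i : 'I_n) : bergman_space 1 (fun z : n.-tuple C => tnth z i).
Proof.
exists (mpolyX _ (mnm1 i)); last by apply/funext => z; rewrite mevalXU.
by move=> e; rewrite msuppX inE => /eqP ->; rewrite mdeg1.
Qed.

Lemma bergman_space_prod (I : Type) (s : seq I) (d : I -> nat)
    (F : I -> n.-tuple C -> C) : (forall i, bergman_space (d i) (F i)) ->
  bergman_space (\sum_(i <- s) d i)%N (fun z => \prod_(i <- s) F i z).
Proof.
move=> sF; elim: s => [|i s IH].
  rewrite big_nil (_ : (fun _ => _) = fun=> 1); first exact: bergman_space_cst.
  by apply/funext => z; rewrite big_nil.
rewrite big_cons (_ : (fun _ => _) = fun z => F i z * \prod_(j <- s) F j z).
  exact: bergman_spaceM.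
by apply/funext => z; rewrite big_cons.
Qed.

Lemma bergman_spaceX (d k : nat) f :
  bergman_space d f -> bergman_space (k * d) (fun z => f z ^+ k).
Proof.
move=> sf; elim: k => [|k IH].
  under eq_fun do rewrite expr0; exact: bergman_space_cst.
by rewrite mulSn; under eq_fun do rewrite exprS; exact: bergman_spaceM.
Qed.

Lemma bergman_space_substitution e (g : n.-tuple C -> n.-tuple C) :
  (forall i, bergman_space 1 (fun z => tnth (g z) i)) ->
  bergman_space (mdeg e) (monomial e \o g).
Proof.
move=> sg; rewrite mdegE.
apply: (@bergman_space_prod _ _ _ (fun i z => tnth (g z) i ^+ e i)) => i.
by have := bergman_spaceX (e i) (sg i); rewrite muln1.
Qed.

Lemma bergman_space_le (m m' : nat) f : (m <= m')%N ->
  bergman_space m f -> bergman_space m' f.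
Proof. by move=> mm' [q qm ->]; exists q => // e /qm /leq_trans; apply. Qed.

End monomials.

(** * The weighted pairing *)

Section weighted_pairing.
Context {R : realType}.
Local Notation RR := (measurableTypeR R).
Local Notation C := R[i].
Variables n m : nat.
Local Notation mu := (@lebesgue_complex R n).
Local Notation mono := (@monomial R n).
Implicit Types (e : multinom n) (b : bmultinom n m.+1) (z : n.-tuple C).
Implicit Types (u f h psi phi : n.-tuple C -> C).

Definition pairing_integrand u h z : C :=
  u z * (h z)^*%C * (bergman_weight m z)%:C.

Lemma bergman_dotE u h :
  bergman_dot m u h = complex_integral mu (pairing_integrand u h).
Proof. by []. Qed.

Lemma bergman_weightE z :
  bergman_weight m z = (n + m)`!%:R / (pi ^+ n * m`!%:R) / rho z ^+ (n + m + 1).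
Proof. by []. Qed.

Lemma bergman_weight_gt0 z : 0 < bergman_weight m z.
Proof.
rewrite bergman_weightE; apply: divr_gt0; last by rewrite exprn_gt0// rho_gt0.
apply: divr_gt0; first by rewrite ltr0n fact_gt0.
by apply: mulr_gt0; [rewrite exprn_gt0 ?pi_gt0|rewrite ltr0n fact_gt0].
Qed.

Lemma measurable_bergman_weight :
  measurable_fun setT (fun z : n.-tuple C => bergman_weight m z : RR).
Proof.
apply: measurable_funM => //; apply: measurable_funR_inv => [z|].
  by rewrite exprn_ge0// ltW// rho_gt0.
by apply: measurable_funX; exact: measurable_rho.
Qed.

Lemma measurable_pairing_integrand u h : measurable_fun setT u ->
  measurable_fun setT h -> measurable_fun setT (pairing_integrand u h).
Proof.
move=> mu_ mh; apply: measurable_funCM.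
  by apply: measurable_funCM => //; exact: measurable_funC_conj.
exact: (measurable_funC_real measurable_bergman_weight).
Qed.

Definition essentially_bounded psi : Prop := measurable_fun setT psi /\
  exists M : R, {ae mu, forall z, normc (psi z) <= M}.

(** Inner products of monomials are pairings with symbol 1, so results on symbols apply to them. *)
Lemma essentially_bounded1 : essentially_bounded (fun=> 1).
Proof.
split; first exact: measurable_cst.
by exists 1; apply: nearW => z; rewrite normc1.
Qed.

Lemma normc_prod (I : Type) (s : seq I) (F : I -> C) :
  normc (\prod_(i <- s) F i) = \prod_(i <- s) normc (F i).
Proof. by apply: (big_morph _ (@normcM R)); exact: normc1. Qed.

Lemma normcX (w : C) k : normc (w ^+ k) = normc w ^+ k.
Proof.
elim: k => [|k IH]; first by rewrite !expr0 normc1.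
by rewrite !exprS normcM IH.
Qed.

(** Each |z_i|^2 is below [rho z], and [rho z] is at least 1, so the exponent may be raised from
    [mdeg e] to [m]. *)
Lemma normc_monomial_le e z : (mdeg e <= m)%N -> normc (mono e z) ^+ 2 <= rho z ^+ m.
Proof.
move=> em; rewrite normc_prod -prodrXl.
apply: (@le_trans _ _ (rho z ^+ mdeg e)); last by rewrite ler_weXn2l// rho_ge1.
rewrite mdegE -prodrXr; apply: ler_prod => i _.
rewrite sqr_ge0/= normcX -exprM mulnC exprM.
rewrite lerXn2r ?nnegrE ?sqr_ge0//; first exact/ltW/rho_gt0.
exact/ltW/normc_lt_rho.
Qed.

Lemma normc_conj (w : C) : normc w^*%C = normc w.
Proof. by case: w => x y; rewrite /normc/= sqrrN. Qed.

Lemma normc_real (r : R) : 0 <= r -> normc (r%:C : C) = r.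
Proof. by move=> r0; rewrite /normc/= expr0n/= addr0 sqrtr_sqr ger0_norm. Qed.

(** By 2 x y <= x^2 + y^2 the two monomials contribute at most rho^m, and the weight rho^-(n+m+1)
    leaves the integrable rho^-(n+1). *)
Lemma cintegrable_monomials psi e e' : essentially_bounded psi ->
  (mdeg e <= m)%N -> (mdeg e' <= m)%N ->
  cintegrable mu (pairing_integrand (psi \* mono e) (mono e')).
Proof.
move=> [mpsi [M psiM]] em em'.
pose K : R := (n + m)`!%:R / (pi ^+ n * m`!%:R).
have K0 : 0 <= K by rewrite divr_ge0 ?mulr_ge0 ?exprn_ge0 ?pi_ge0 ?ler0n.
(* The sign of the essential bound [M] is not given, hence the absolute value. *)
apply: (@cintegrable_le _ _ _ _ _ (fun z => `|M| * K * (rho z ^+ n.+1)^-1)).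
- apply: measurable_pairing_integrand; last exact: measurable_monomial.
  by apply: measurable_funCM => //; exact: measurable_monomial.
- apply: (eq_integrable measurableT _ _ _
    (integrableZl measurableT (`|M| * K) (rho_inv_integrable n))) => z _ /=.
  by rewrite -EFinM.
apply: filterS psiM => z psiz.
rewrite /pairing_integrand !normcM normc_conj normc_real; last first.
  exact/ltW/bergman_weight_gt0.
rewrite bergman_weightE -/K; clearbody K.
have r0 := rho_gt0 z.
have -> : (n + m + 1 = n.+1 + m)%N by lia.
rewrite exprD invfM -!mulrA.
have A0 : 0 <= (rho z ^+ n.+1)^-1 by rewrite invr_ge0 exprn_ge0// ltW.
have B0 : 0 < rho z ^+ m by rewrite exprn_gt0.
have a0 := normc_ge0 (mono e z); have b0 := normc_ge0 (mono e' z).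
have ab : normc (mono e z) * normc (mono e' z) <= rho z ^+ m.
  have := normc_monomial_le z em; have := normc_monomial_le z em'.
  have := sqr_ge0 (normc (mono e z) - normc (mono e' z)).
  by rewrite sqrrB; lra.
apply: ler_pM; first exact: normc_ge0.
- have Bi : 0 <= (rho z ^+ m)^-1 by rewrite invr_ge0 ltW.
  exact: mulr_ge0 a0 (mulr_ge0 b0 (mulr_ge0 K0 (mulr_ge0 A0 Bi))).
- by rewrite (le_trans psiz)// ler_norm.
rewrite [leLHS](_ : _ = (normc (mono e z) * normc (mono e' z) / rho z ^+ m) *
  (K * (rho z ^+ n.+1)^-1)); last by ring.
by rewrite ler_piMl ?mulr_ge0// ler_pdivrMr// mul1r.
Qed.

Lemma bergman_dotD u u' h : cintegrable mu (pairing_integrand u h) ->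
  cintegrable mu (pairing_integrand u' h) ->
  bergman_dot m (fun z => u z + u' z) h = bergman_dot m u h + bergman_dot m u' h.
Proof.
move=> iu iu'; rewrite !bergman_dotE -cintegralD//; congr complex_integral.
by apply/funext => z; rewrite /pairing_integrand !mulrDl.
Qed.

Lemma pairing_integrandZ (c : C) u h :
  pairing_integrand (fun z => c * u z) h = fun z => c * pairing_integrand u h z.
Proof. by apply/funext => z; rewrite /pairing_integrand !mulrA. Qed.

Lemma bergman_dotZ (c : C) u h : cintegrable mu (pairing_integrand u h) ->
  bergman_dot m (fun z => c * u z) h = c * bergman_dot m u h.
Proof. by move=> iu; rewrite !bergman_dotE pairing_integrandZ cintegralZ. Qed.

Lemma pairing_integrand_suml (I : finType) (c : I -> C) (F : I -> n.-tuple C -> C) h :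
  pairing_integrand (fun z => \sum_i c i * F i z) h =
  fun z => \sum_i c i * pairing_integrand (F i) h z.
Proof.
apply/funext => z; rewrite /pairing_integrand !mulr_suml.
by apply: eq_bigr => i _; rewrite !mulrA.
Qed.

Lemma pairing_integrand_sumr (I : finType) (c : I -> C) (F : I -> n.-tuple C -> C) u :
  pairing_integrand u (fun z => \sum_i c i * F i z) =
  fun z => \sum_i (c i)^*%C * pairing_integrand u (F i) z.
Proof.
apply/funext => z; rewrite /pairing_integrand rmorph_sum /= mulr_sumr mulr_suml.
by apply: eq_bigr => i _; rewrite rmorphM /=; ring.
Qed.

Lemma bergman_dot_suml (I : finType) (c : I -> C) (F : I -> n.-tuple C -> C) h :
  (forall i, cintegrable mu (pairing_integrand (F i) h)) ->
  bergman_dot m (fun z => \sum_i c i * F i z) h =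
  \sum_i c i * bergman_dot m (F i) h.
Proof.
move=> iF; rewrite bergman_dotE pairing_integrand_suml cintegral_sum.
  by apply: eq_bigr => i _; rewrite cintegralZ.
by move=> i _; exact: cintegrableZ.
Qed.

Lemma bergman_dot_sumr (I : finType) (c : I -> C) (F : I -> n.-tuple C -> C) u :
  (forall i, cintegrable mu (pairing_integrand u (F i))) ->
  bergman_dot m u (fun z => \sum_i c i * F i z) =
  \sum_i (c i)^*%C * bergman_dot m u (F i).
Proof.
move=> iF; rewrite bergman_dotE pairing_integrand_sumr cintegral_sum.
  by apply: eq_bigr => i _; rewrite cintegralZ.
by move=> i _; exact: cintegrableZ.
Qed.

End weighted_pairing.

(** * Matrix coefficients of Toeplitz operators *)

Section unimodular_numbers.
Context {R : realType}.
Local Notation C := R[i].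

Lemma conj_unimodular (a b : R) : a ^+ 2 + b ^+ 2 = 1 ->
  ((a +i* b)^*)%C = (a +i* b : C)^-1.
Proof.
move=> ab; have h : (a +i* b : C) * ((a +i* b)^*)%C = 1.
  by rewrite /=; simpc; rewrite -!expr2 ab (mulrC b) addNr.
have z0 : (a +i* b : C) != 0.
  by apply: contra_eq_neq h => ->; rewrite mul0r eq_sym oner_neq0.
by apply: (mulfI z0); rewrite h mulfV.
Qed.

(** Take [w] with w^(2|d|) = -1. Both w^d = 1 and w = -1 would give w^(2|d|) = 1. Excluding w = -1
    is the condition 1 + a != 0 of the shear factorisation. *)
Lemma unimodular_expz_neq1 (d : int) : d != 0 ->
  exists a b : R, [/\ a ^+ 2 + b ^+ 2 = 1, 1 + a != 0 & (a +i* b : C) ^ d != 1].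
Proof.
move=> d0; pose N := `|d|%N; have N0 : (0 < N)%N by rewrite absz_gt0.
pose w : C := (N.*2).-root (-1).
have wN : w ^+ N.*2 = -1 by rewrite rootCK// double_gt0.
have w1 : normc w = 1.
  apply/eqP; rewrite -(@pexpr_eq1 _ _ N.*2) ?double_gt0 ?normc_ge0//.
  by rewrite -normcX wN normcN normc1.
have m11 : -1 != 1 :> C.
  by rewrite eq_sym -subr_eq0 opprK; rewrite (_ : 1 + 1 = 2%:R)// pnatr_eq0.
exists (complex.Re w), (complex.Im w); split.
- have := congr1 (fun x => x ^+ 2) w1; rewrite normc_sqrt sqr_sqrtr ?addr_ge0 ?sqr_ge0//.
  by rewrite expr1n.
- apply/eqP => a1; have aE : complex.Re w = -1 by lra.
  have bE : complex.Im w = 0.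
    have := congr1 (fun x => x ^+ 2) w1; rewrite normc_sqrt sqr_sqrtr ?addr_ge0 ?sqr_ge0//.
    rewrite aE expr1n sqrrN expr1n => /eqP; rewrite -subr_eq0 addrC addKr.
    by rewrite sqrf_eq0 => /eqP.
  have wE : w = -1.
    by apply/eqP; rewrite eq_complex aE bE /= oppr0 !eqxx.
  case/eqP: m11; rewrite -[LHS]wN wE.
  by rewrite -mul2n exprM sqrrN !expr1n.
rewrite (_ : _ +i* _ = w); last by case: (w).
apply/negP => /eqP wd.
have wN1 : w ^+ N = 1.
  move: wd; rewrite /N; case: (d) => k //=.
  by rewrite NegzE -exprnN => /(congr1 GRing.inv); rewrite invrK invr1.
by case/eqP: m11; rewrite -[LHS]wN -muln2 exprM wN1 expr1n.
Qed.

End unimodular_numbers.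

Section pairing_invariance.
Context {R : realType}.
Local Notation RR := (measurableTypeR R).
Local Notation C := R[i].
Variables n m : nat.
Local Notation mu := (@lebesgue_complex R n).
Local Notation mono := (@monomial R n).
Implicit Types (e : multinom n) (b : bmultinom n m.+1) (z : n.-tuple C).
Implicit Types (u f h psi phi : n.-tuple C -> C).

(** The weight depends on z only through [rho], so [g] preserves the weighted measure. *)
Lemma bergman_dot_comp (g : n.-tuple C -> n.-tuple C) u h :
  scales mu g 1 -> (forall z, rho (g z) = rho z) ->
  measurable_fun setT u -> measurable_fun setT h ->
  cintegrable mu (pairing_integrand m u h) ->
  bergman_dot m (u \o g) (h \o g) = bergman_dot m u h.
Proof.
move=> sg rg mu_ mh iuh; rewrite !bergman_dotE.
have [_ <-] := cintegral_comp sg (measurable_pairing_integrand m mu_ mh) iuh.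
congr complex_integral; apply/funext => z.
by rewrite /pairing_integrand /= !bergman_weightE rg.
Qed.

Lemma rho_phase_rotation i (a b : R) z : a ^+ 2 + b ^+ 2 = 1 ->
  rho (phase_rotation i (a +i* b) z) = rho z.
Proof.
move=> ab; congr (1 + _); apply: eq_bigr => j _; rewrite tnth_mktuple.
case: eqP => // ->; rewrite normcM (_ : normc (a +i* b) = 1) ?mul1r//.
by rewrite /normc ab sqrtr1.
Qed.

Lemma monomial_phase_rotation i (c : C) e z :
  mono e (phase_rotation i c z) = c ^+ e i * mono e z.
Proof.
rewrite /monomial (bigD1 i)//= [in RHS](bigD1 i)//= mulrA -exprMn.
rewrite tnth_mktuple eqxx; congr (_ * _); apply: eq_bigr => j ji.
by rewrite tnth_mktuple (negbTE ji).
Qed.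

(* Under z_i -> w z_i with |w| = 1 the integrand is multiplied by
   w ^ (q + e_i - e'_i), so the integral vanishes unless this exponent is 0. *)
Lemma bergman_dot_phase_eq0 psi i (q : int) e e' :
  essentially_bounded psi -> (mdeg e <= m)%N -> (mdeg e' <= m)%N ->
  (forall (a b : R) z, a ^+ 2 + b ^+ 2 = 1 ->
    psi (phase_rotation i (a +i* b) z) = (a +i* b) ^ q * psi z) ->
  (e' i)%:Z != (e i)%:Z + q ->
  bergman_dot m (psi \* mono e) (mono e') = 0.
Proof.
move=> bpsi em em' psiq d0.
have [|a [b [ab a1]]] := @unimodular_expz_neq1 R ((e i)%:Z + q - (e' i)%:Z).
  by rewrite subr_eq0 eq_sym.
have cw := conj_unimodular ab; have psiw z := psiq a b z ab.
have sw := scales_phase_rotation i ab a1.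
have rw z := rho_phase_rotation i z ab.
have w1 : normc (a +i* b) = 1 by rewrite /normc ab sqrtr1.
move: (a +i* b) cw psiw sw rw w1 => w cw psiw sw rw w1 wd.
have int := cintegrable_monomials bpsi em em'.
have w0 : w != 0.
  by apply/eqP => w00; move: w1; rewrite w00 normc0 => /esym/eqP; rewrite oner_eq0.
have mpsi : measurable_fun setT (psi \* mono e).
  by apply: measurable_funCM; [case: bpsi|exact: measurable_monomial].
have := bergman_dot_comp sw rw mpsi (measurable_monomial e') int.
rewrite bergman_dotE (_ : pairing_integrand _ _ _ = fun z =>
  w ^ ((e i)%:Z + q - (e' i)%:Z) * pairing_integrand m (psi \* mono e) (mono e') z).
  rewrite cintegralZ// !bergman_dotE; set D := complex_integral _ _ => /eqP.
  rewrite -subr_eq0 -[X in _ - X]mul1r -mulrBl mulf_eq0 subr_eq0 (negbTE wd).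
  by move/eqP.
apply/funext => z; rewrite /pairing_integrand /=.
rewrite psiw !monomial_phase_rotation rmorphM rmorphXn /= cw.
rewrite !expfzDr// -exprz_inv -!exprnP.
by ring.
Qed.

End pairing_invariance.

(** * The Bergman projection in the monomial basis *)

Section projection.
Context {R : realType}.
Local Notation RR := (measurableTypeR R).
Local Notation C := R[i].
Variables n m : nat.
Local Notation mu := (@lebesgue_complex R n).
Local Notation mono := (@monomial R n).
Local Notation dot := (@bergman_dot R n m).
Local Notation basis := (bmultinom n m.+1).
Implicit Types (e : multinom n) (b : basis) (z : n.-tuple C).
Implicit Types (u f h psi phi : n.-tuple C -> C).

Lemma mdeg_basis b : (mdeg (bmnm b) <= m)%N.
Proof. by rewrite -ltnS bmdeg. Qed.

Lemma one_mul_fun u : (fun=> 1) \* u = u.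
Proof. by apply/funext => z /=; rewrite mul1r. Qed.

Lemma cintegrable_monomial2 e e' : (mdeg e <= m)%N -> (mdeg e' <= m)%N ->
  cintegrable mu (pairing_integrand m (mono e) (mono e')).
Proof.
move=> em em'; rewrite -[mono e]one_mul_fun.
exact: cintegrable_monomials (@essentially_bounded1 R n) em em'.
Qed.

Lemma monomial_orthogonal e e' : (mdeg e <= m)%N -> (mdeg e' <= m)%N ->
  e != e' -> dot (mono e) (mono e') = 0.
Proof.
move=> em em' ee'; rewrite -[mono e]one_mul_fun.
have [i ei] : exists i, e' i != e i.
  apply/existsP; apply: contraNT ee'; rewrite negb_exists => /forallP h.
  by apply/eqP/mnmP => i; have := h i; rewrite negbK => /eqP.
apply: (@bergman_dot_phase_eq0 _ _ _ _ i 0) => //; first exact: essentially_bounded1.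
  by move=> a b z _; rewrite expr0z mul1r.
by rewrite addr0.
Qed.

(** The integrand is positive off the coordinate hyperplanes. A zero integral would make almost
    every point lie on them, and then a polysquare of measure 4^n would be null. *)
Lemma monomial_norm_neq0 e : (mdeg e <= m)%N -> dot (mono e) (mono e) != 0.
Proof.
move=> em; apply/eqP => /(congr1 (@complex.Re R)) /=.
have [ir _] := cintegrable_monomial2 em em.
pose f z : R := normc (mono e z) ^+ 2 * bergman_weight m z.
have fE z : complex.Re (pairing_integrand m (mono e) (mono e) z) = f z.
  rewrite /pairing_integrand /f normc_sqrt sqr_sqrtr ?addr_ge0 ?sqr_ge0//.
  by case: (mono e z) => x y; simpc; rewrite /= -!expr2.
have f0 z : 0 <= f z by rewrite mulr_ge0 ?sqr_ge0// ltW// bergman_weight_gt0.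
rewrite /Rintegral => /eqP; rewrite fine_eq0; last exact: integrable_fin_num.
move=> /eqP intf0.
have /ae_eq_integral_abs : (\int[mu]_z `|(f z)%:E|)%E = 0%E.
  by rewrite -[RHS]intf0; apply: eq_integral => z _; rewrite fE gee0_abs ?lee_fin.
have mf : measurable_fun setT (fun z => (f z)%:E).
  have [/integrableP[+ _] _] := cintegrable_monomial2 em em.
  by apply: eq_measurable_fun => z _ /=; rewrite fE.
move=> /(_ measurableT mf) f_ae.
have := negligibleU f_ae (@some_tnth_eq0_negligible R n).
have S1 := @lebesgue_complex_polysquare R n 1 ltr01.
move=> neg; have : mu.-negligible (@polysquare R n 1).
  apply: negligibleS neg => z _; apply: contrapT => /not_orP[/= /contrapT fz z0].
  have := fz I => -[] /eqP; apply/negP; rewrite mulf_neq0 ?gt_eqF//.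
    rewrite exprn_gt0// normc_prod; apply: prodr_gt0 => i _.
    rewrite normcX exprn_gt0// normc_gt0// => zi.
    by apply: z0; exists i.
  exact: bergman_weight_gt0.
move/(negligibleP _ (@measurable_polysquare R n 1)) => /(etrans (esym S1)) -[] /eqP.
by apply/negP; rewrite expf_neq0// mulf_neq0// expf_neq0// oner_neq0.
Qed.

(** Stands in for membership in L^2: the projection is determined by pairings with basis monomials,
    so their integrability suffices. *)
Definition admissible u : Prop :=
  forall b, cintegrable mu (pairing_integrand m u (mono (bmnm b))).

Definition projection_coef u b : C :=
  dot u (mono (bmnm b)) / dot (mono (bmnm b)) (mono (bmnm b)).

Lemma bergman_dot_monomial (c : basis -> C) b :
  dot (fun z => \sum_b' c b' * mono (bmnm b') z) (mono (bmnm b)) =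
  c b * dot (mono (bmnm b)) (mono (bmnm b)).
Proof.
rewrite bergman_dot_suml; last first.
  by move=> b'; apply: cintegrable_monomial2; exact: mdeg_basis.
rewrite (bigD1 b)//= big1 ?addr0// => b' b'b.
have b'b' : bmnm b' != bmnm b by apply: contra_neq b'b => h; exact: val_inj.
by rewrite (monomial_orthogonal (mdeg_basis b') (mdeg_basis b) b'b') mulr0.
Qed.

Lemma cintegrable_sum_monomial (c : basis -> C) b :
  cintegrable mu (pairing_integrand m
    (fun z => \sum_b' c b' * mono (bmnm b') z) (mono (bmnm b))).
Proof.
rewrite pairing_integrand_suml; apply: cintegrable_sum => b' _.
by apply: cintegrableZ; apply: cintegrable_monomial2; exact: mdeg_basis.
Qed.

Lemma bergman_dot_subr u (c : basis -> C) b : admissible u ->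
  cintegrable mu (pairing_integrand m
    (u \- fun z => \sum_b' c b' * mono (bmnm b') z) (mono (bmnm b))) /\
  dot (u \- fun z => \sum_b' c b' * mono (bmnm b') z) (mono (bmnm b)) =
  dot u (mono (bmnm b)) - c b * dot (mono (bmnm b)) (mono (bmnm b)).
Proof.
move=> au.
rewrite (_ : u \- _ = fun z => u z + -1 * (\sum_b' c b' * mono (bmnm b') z)).
  have ic := cintegrable_sum_monomial c b.
  have iN := cintegrableZ (-1) ic.
  rewrite -pairing_integrandZ in iN.
  split; last by rewrite bergman_dotD// bergman_dotZ// bergman_dot_monomial mulN1r.
  rewrite (_ : pairing_integrand _ _ _ = fun z =>
    pairing_integrand m u (mono (bmnm b)) z + pairing_integrand m (fun z =>
      -1 * (\sum_b' c b' * mono (bmnm b') z)) (mono (bmnm b)) z).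
    by apply: cintegrableD => //; exact: au.
  by apply/funext => z; rewrite /pairing_integrand !mulrDl.
by apply/funext => z /=; rewrite mulN1r.
Qed.

(** The explicit sum satisfies the defining property, so [xget] does not fall back on its default.
    Any other choice of [xget] has the same coefficients, read off by testing against monomials of
    nonzero norm. *)
Lemma bergman_projectionE u : admissible u ->
  bergman_projection m u =
  fun z => \sum_b projection_coef u b * mono (bmnm b) z.
Proof.
move=> au; rewrite /bergman_projection.
set P := [set g | _].
have Pg : P (fun z => \sum_b projection_coef u b * mono (bmnm b) z).
  split; first by apply/bergman_spaceP; eexists.
  move=> h /bergman_spaceP[c ->]; rewrite bergman_dot_sumr; last first.
    by move=> b; have [] := bergman_dot_subr (projection_coef u) b au.
  apply: big1 => b _; have [_ ->] := bergman_dot_subr (projection_coef u) b au.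
  by rewrite divfK ?subrr ?mulr0//; apply: monomial_norm_neq0; exact: mdeg_basis.
have [/bergman_spaceP[c gE]] : P (xget (fun=> 0) P) by apply: xgetPex; eexists; exact: Pg.
rewrite gE => Pc; apply/funext => z; apply: eq_bigr => b _; congr (_ * _).
have [_ E] := bergman_dot_subr c b au.
have := Pc _ (@bergman_space_monomial R n m _ (mdeg_basis b)); rewrite E => /eqP.
rewrite subr_eq0 => /eqP cb; rewrite /projection_coef cb mulfK//.
by apply: monomial_norm_neq0; exact: mdeg_basis.
Qed.

Lemma toeplitzE psi (c : basis -> C) : essentially_bounded psi ->
  toeplitz m psi (fun z => \sum_b c b * mono (bmnm b) z) =
  fun z => \sum_b' (\sum_b c b * projection_coef (psi \* mono (bmnm b)) b') *
    mono (bmnm b') z.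
Proof.
move=> bpsi; rewrite /toeplitz.
rewrite (_ : psi \* _ = fun z => \sum_b c b * (psi \* mono (bmnm b)) z); last first.
  by apply/funext => z /=; rewrite mulr_sumr; apply: eq_bigr => b _; rewrite mulrCA.
have ib b b' : cintegrable mu (pairing_integrand m (psi \* mono (bmnm b)) (mono (bmnm b'))).
  by apply: cintegrable_monomials => //; exact: mdeg_basis.
rewrite bergman_projectionE; last first.
  move=> b'; rewrite pairing_integrand_suml; apply: cintegrable_sum => b _.
  exact: cintegrableZ.
apply/funext => z; apply: eq_bigr => b' _; congr (_ * _).
rewrite /projection_coef bergman_dot_suml// mulr_suml.
by apply: eq_bigr => b _; rewrite mulrA.
Qed.

Let sum_comp (I : finType) (c : I -> C) (F G : I -> I -> C) i :
  \sum_j (\sum_k c k * F k j) * G j i = \sum_k c k * \sum_j F k j * G j i.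
Proof.
under eq_bigr do rewrite mulr_suml.
rewrite exchange_big; apply: eq_bigr => k _; rewrite mulr_sumr.
by apply: eq_bigr => j _; rewrite mulrA.
Qed.

Lemma commute_on_bergman_coef psi phi :
  essentially_bounded psi -> essentially_bounded phi ->
  (forall b b', \sum_b1 projection_coef (psi \* mono (bmnm b)) b1 *
                        projection_coef (phi \* mono (bmnm b1)) b' =
                \sum_b1 projection_coef (phi \* mono (bmnm b)) b1 *
                        projection_coef (psi \* mono (bmnm b1)) b') ->
  commute_on_bergman m (toeplitz m psi) (toeplitz m phi).
Proof.
move=> bpsi bphi com f /bergman_spaceP[c ->]; rewrite !toeplitzE//.
apply/funext => z; apply: eq_bigr => b' _; congr (_ * _).
rewrite (sum_comp c (fun b b' => projection_coef (phi \* mono (bmnm b)) b')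
  (fun b b' => projection_coef (psi \* mono (bmnm b)) b')).
rewrite (sum_comp c (fun b b' => projection_coef (psi \* mono (bmnm b)) b')
  (fun b b' => projection_coef (phi \* mono (bmnm b)) b')).
by apply: eq_bigr => b _; rewrite com.
Qed.

End projection.

(** * Monomials under a plane rotation *)

Section plane_rotation_theory.
Context {R : realType}.
Local Notation C := R[i].
Variable n : nat.
Implicit Types (e f : multinom n) (z : n.-tuple C).

Lemma plane_rotationK (u v : 'I_n) (a b : R) : u != v -> a ^+ 2 + b ^+ 2 = 1 ->
  cancel (plane_rotation u v a b) (plane_rotation u v a (- b)).
Proof.
move=> uv ab z; have vu : v != u by rewrite eq_sym.
have abC : a%:C ^+ 2 + b%:C ^+ 2 = 1 :> C by rewrite -!rmorphXn -rmorphD/= ab.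
apply: eq_from_tnth => i; rewrite /plane_rotation !tnth_mktuple !eqxx (negbTE vu).
case: eqP => [->|_]; last case: eqP => [->|//]; rewrite rmorphN.
  by transitivity ((a%:C ^+ 2 + b%:C ^+ 2) * tnth z u); [ring|rewrite abC mul1r].
by transitivity ((a%:C ^+ 2 + b%:C ^+ 2) * tnth z v); [ring|rewrite abC mul1r].
Qed.

Lemma normc_rotation (a b : R) (x y : C) : a ^+ 2 + b ^+ 2 = 1 ->
  normc (a%:C * x - b%:C * y) ^+ 2 + normc (b%:C * x + a%:C * y) ^+ 2 =
  normc x ^+ 2 + normc y ^+ 2.
Proof.
move=> ab; rewrite !normc_sqrt !sqr_sqrtr ?addr_ge0 ?sqr_ge0//.
case: x y => [x1 x2] [y1 y2] /=; rewrite !(mul0r, subr0, addr0, add0r).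
by rewrite -[RHS]mul1r -ab; ring.
Qed.

Lemma rho_plane_rotation (u v : 'I_n) (a b : R) z : u != v ->
  a ^+ 2 + b ^+ 2 = 1 -> rho (plane_rotation u v a b z) = rho z.
Proof.
move=> uv ab; have vu : v != u by rewrite eq_sym.
congr (1 + _); rewrite (bigD1 u)//= (bigD1 v)//= [RHS](bigD1 u)//= [X in _ = _ + X](bigD1 v)//=.
rewrite !addrA; congr (_ + _); last first.
  by apply: eq_bigr => i /andP[/negbTE iu /negbTE iv]; rewrite tnth_mktuple iu iv.
by rewrite !tnth_mktuple !eqxx (negbTE vu) normc_rotation.
Qed.

Lemma bergman_space_plane_rotation (u v : 'I_n) (a b : R) i :
  bergman_space 1 (fun z : n.-tuple C => tnth (plane_rotation u v a b z) i).
Proof.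
have lin (c c' : C) : bergman_space 1
    (fun z : n.-tuple C => c * tnth z u + c' * tnth z v).
  apply: bergman_spaceD.
    exact: (bergman_spaceM (@bergman_space_cst R n 0 c) (@bergman_space_coordinate R n u)).
  exact: (bergman_spaceM (@bergman_space_cst R n 0 c') (@bergman_space_coordinate R n v)).
under eq_fun do rewrite tnth_mktuple.
have [_|_] := eqVneq i u.
  by under eq_fun do rewrite -mulNr; exact: lin.
by have [_|_] := eqVneq i v; [exact: lin|exact: bergman_space_coordinate].
Qed.

(** These are the exponents in the expansion of a rotated monomial. The subtraction is truncated, so
    the degree is kept for j <= e u + e v; j = 0 puts the whole exponent on [u]. *)
Definition redistribute e (u v : 'I_n) (j : nat) : multinom n :=
  Multinom [tuple if i == u then (e u + e v - j)%N else if i == v then j else e i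
  | i < n].

Lemma redistributeE e u v j i : redistribute e u v j i =
  if i == u then (e u + e v - j)%N else if i == v then j else e i.
Proof. by rewrite /redistribute /fun_of_multinom /= tnth_mktuple. Qed.

Lemma redistribute_id e u v : u != v -> redistribute e u v (e v) = e.
Proof.
move=> uv; apply/mnmP => i; rewrite redistributeE addnK.
by case: eqP => [->//|_]; case: eqP => [->|].
Qed.

Lemma mdeg_redistribute e u v j : u != v -> (j <= e u + e v)%N ->
  mdeg (redistribute e u v j) = mdeg e.
Proof.
move=> uv jN; have vu : v != u by rewrite eq_sym.
rewrite !mdegE (bigD1 u)//= (bigD1 v)//= [RHS](bigD1 u)//= [X in _ = (_ + X)%N](bigD1 v)//=.
rewrite !redistributeE !eqxx (negbTE vu) !addnA subnK//; congr (_ + _)%N.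
by apply: eq_bigr => i /andP[/negbTE iu /negbTE iv]; rewrite redistributeE iu iv.
Qed.

Let rest e (u v : 'I_n) z : C := \prod_(i < n | (i != u) && (i != v)) tnth z i ^+ e i.

Let monomial_redistribute e u v j z : u != v ->
  monomial (redistribute e u v j) z =
  tnth z u ^+ (e u + e v - j) * tnth z v ^+ j * rest e u v z.
Proof.
move=> uv; have vu : v != u by rewrite eq_sym.
rewrite /monomial (bigD1 u)//= (bigD1 v)//= !redistributeE !eqxx (negbTE vu).
rewrite mulrA; congr (_ * _).
by apply: eq_bigr => i /andP[/negbTE iu /negbTE iv]; rewrite redistributeE iu iv.
Qed.

(** The coefficient of x^(N-j) y^j in (a x - b y)^N. *)
Definition rotation_coef (a b : R) (N : nat) (j : nat) : C :=
  (a%:C ^+ (N - j) * (- b%:C) ^+ j) *+ 'C(N, j).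

Lemma monomial_plane_rotation e u v (a b : R) z : u != v ->
  monomial (redistribute e u v 0) (plane_rotation u v a b z) =
  \sum_(j < (e u + e v).+1)
    rotation_coef a b (e u + e v) j * monomial (redistribute e u v j) z.
Proof.
move=> uv; rewrite monomial_redistribute// expr0 mulr1 subn0 !tnth_mktuple eqxx.
have -> : rest e u v (plane_rotation u v a b z) = rest e u v z.
  by apply: eq_bigr => i /andP[/negbTE iu /negbTE iv]; rewrite tnth_mktuple iu iv.
rewrite -mulNr exprDn mulr_suml; apply: eq_bigr => j _.
rewrite monomial_redistribute// /rotation_coef mulrnAl mulrnAl.
by rewrite !exprMn; congr (_ *+ _); ring.
Qed.

Lemma rotation_coef_neq0 (a b : R) N j : (j <= N)%N -> a != 0 -> b != 0 ->
  rotation_coef a b N j != 0.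
Proof.
move=> jN a0 b0; rewrite /rotation_coef -mulr_natr !mulf_neq0 ?expf_neq0 ?oppr_eq0//.
- by rewrite fmorph_eq0.
- by rewrite fmorph_eq0.
- by rewrite pnatr_eq0 -lt0n bin_gt0.
Qed.

End plane_rotation_theory.

(** * Coefficients depend on a block through its sum only *)

Section matrix_coefficients.
Context {R : realType}.
Local Notation RR := (measurableTypeR R).
Local Notation C := R[i].
Variables n m : nat.
Local Notation mu := (@lebesgue_complex R n).
Local Notation mono := (@monomial R n).
Local Notation dot := (@bergman_dot R n m).
Implicit Types (e f : multinom n) (z : n.-tuple C) (p q : 'I_n -> int).
Implicit Types (psi phi : n.-tuple C -> C).

Definition torus_weight psi p : Prop := forall i (a b : R) z, a ^+ 2 + b ^+ 2 = 1 ->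
  psi (phase_rotation i (a +i* b) z) = (a +i* b) ^ p i * psi z.

Definition rotation_invariant psi (u v : 'I_n) : Prop :=
  forall (a b : R) z, a ^+ 2 + b ^+ 2 = 1 -> psi (plane_rotation u v a b z) = psi z.

(** A relation rather than a function, because e + p may have negative entries. *)
Definition shifted p e e' : Prop := forall i, (e' i)%:Z = (e i)%:Z + p i.

(** When [shifted p e e'] holds for the weight p of [psi], this is the factor gamma(e) of the
    weighted shift. *)
Definition matrix_coef psi e e' : C :=
  dot (psi \* mono e) (mono e') / dot (mono e') (mono e').

Lemma bergman_dot_not_shifted psi p e e' : essentially_bounded psi ->
  torus_weight psi p -> (mdeg e <= m)%N -> (mdeg e' <= m)%N ->
  ~ shifted p e e' -> dot (psi \* mono e) (mono e') = 0.
Proof.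
move=> bpsi wpsi em em' /existsNP[i /eqP ei].
exact: (bergman_dot_phase_eq0 bpsi em em' (wpsi i) ei).
Qed.

Lemma shifted_redistribute p e e' u v j : p u = 0 -> p v = 0 ->
  shifted p e e' -> shifted p (redistribute e u v j) (redistribute e' u v j).
Proof.
move=> pu pv ee' i; rewrite !redistributeE.
have := ee' u; rewrite pu addr0 => -[->]; have := ee' v; rewrite pv addr0 => -[->].
by case: eqP => [->|_]; [rewrite pu addr0|case: eqP => [->|//]; rewrite pv addr0].
Qed.

Lemma shifted_inj p e e' f' : shifted p e e' -> shifted p e f' -> e' = f'.
Proof. by move=> h h'; apply/mnmP => i; have := h i; rewrite -h' => -[]. Qed.

(** Pair psi z^(e_0) with the monomial z^(e'_j) rotated backwards, where the index is the argument
    of [redistribute], and apply the invariance of the pairing under the rotation. Expanding the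
    rotated z^(e_0) leaves [c] times one pairing; expanding the other monomial leaves [d] times
    another. The quantifier order matters: [c] and [d] are chosen before [psi], [p] and [e]. *)
Let key u v e' j : u != v -> (j <= e' u + e' v)%N -> (mdeg e' <= m)%N ->
  exists c d : C, c != 0 /\ forall psi p e, essentially_bounded psi ->
    torus_weight psi p -> rotation_invariant psi u v -> p u = 0 -> p v = 0 ->
    (mdeg e <= m)%N -> shifted p e e' ->
    c * dot (psi \* mono (redistribute e u v j)) (mono (redistribute e' u v j)) =
    d * dot (psi \* mono (redistribute e u v 0)) (mono (redistribute e' u v 0)).
Proof.
(* A rational point of the unit circle with a, b and 1 + a nonzero, so that no expansion coefficient
   vanishes and the shear factorisation applies. *)
move=> uv jN em'; pose a : R := 3 / 5; pose b : R := 4 / 5.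
have ab : a ^+ 2 + b ^+ 2 = 1 by rewrite /a /b; lra.
have a1 : 1 + a != 0 by rewrite /a; lra.
set ej' := redistribute e' u v j; set e0' := redistribute e' u v 0.
have ej'm : (mdeg ej' <= m)%N by rewrite mdeg_redistribute.
have e0'm : (mdeg e0' <= m)%N by rewrite mdeg_redistribute.
pose g := @plane_rotation R n u v a b; pose g' := @plane_rotation R n u v a (- b).
(* The monomial composed with the inverse rotation is a polynomial of degree at most [m] whose
   coefficients do not involve the symbol; [d] is the conjugate of one of them. *)
have [c' hE] : exists c' : bmultinom n m.+1 -> C,
    mono ej' \o g' = fun z => \sum_b c' b * mono (bmnm b) z.
  apply/bergman_spaceP; apply: bergman_space_le ej'm _.
  apply: bergman_space_substitution => i; exact: bergman_space_plane_rotation.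
have e0'b : (mdeg e0' < m.+1)%N by rewrite ltnS.
pose b0 := BMultinom e0'b.
exists (rotation_coef a b (e' u + e' v) j), ((c' b0)^*)%C; split.
  by apply: rotation_coef_neq0 => //; rewrite ?/a ?/b; lra.
move=> psi p e bpsi wpsi rpsi pu pv em ee'.
have eu : e u = e' u by have := ee' u; rewrite pu addr0 => -[].
have ev : e v = e' v by have := ee' v; rewrite pv addr0 => -[].
have ejm i : (i <= e u + e v)%N -> (mdeg (redistribute e u v i) <= m)%N.
  by move=> iN; rewrite mdeg_redistribute.
set U := psi \* mono (redistribute e u v 0).
have mU : measurable_fun setT U.
  by apply: measurable_funCM; [case: bpsi|exact: measurable_monomial].
have iU (b1 : bmultinom n m.+1) :
    cintegrable mu (pairing_integrand m U (mono (bmnm b1))).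
  by apply: cintegrable_monomials => //; [exact: ejm|exact: mdeg_basis].
have mh : measurable_fun setT (mono ej' \o g').
  by rewrite hE; apply: measurable_funC_sum => b1; apply: measurable_funCM;
    [exact: measurable_cst|exact: measurable_monomial].
have ih : cintegrable mu (pairing_integrand m U (mono ej' \o g')).
  rewrite hE pairing_integrand_sumr; apply: cintegrable_sum => b1 _.
  exact: cintegrableZ.
have := bergman_dot_comp (scales_plane_rotation uv ab a1)
  (fun z => rho_plane_rotation z uv ab) mU mh ih.
rewrite [X in dot _ X = _ -> _](_ : _ = mono ej'); last first.
  by apply/funext => z /=; rewrite /g' plane_rotationK.
rewrite [X in dot X _ = _ -> _](_ : _ = fun z => \sum_(i < (e u + e v).+1)
    rotation_coef a b (e u + e v) i * (psi \* mono (redistribute e u v i)) z); last first.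
  apply/funext => z; rewrite /U /= rpsi// monomial_plane_rotation// mulr_sumr.
  by apply: eq_bigr => i _; rewrite mulrCA.
rewrite bergman_dot_suml; last first.
  by move=> i; apply: cintegrable_monomials => //; apply: ejm; rewrite -ltnS.
have jN' : (j < (e u + e v).+1)%N by rewrite ltnS eu ev.
(* As p v = 0, a nonzero pairing needs equal exponents at [v], which selects the term i = j. *)
rewrite (bigD1 (Ordinal jN'))//= big1 ?addr0; last first.
  move=> i ij; rewrite (bergman_dot_not_shifted bpsi wpsi) ?mulr0//.
    by apply: ejm; rewrite -ltnS.
  move=> /(_ v); rewrite !redistributeE eq_sym (negbTE uv) eqxx pv addr0 => -[ji].
  by case/eqP: ij; apply/val_inj; rewrite /= ji.
rewrite eu ev => ->.
(* On the other side only the shift of e_0 by p, which is e'_0, survives. *)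
rewrite hE bergman_dot_sumr// (bigD1 b0)//= big1 ?addr0// => b1 b1b0.
rewrite (bergman_dot_not_shifted bpsi wpsi) ?mulr0//; [exact: ejm|exact: mdeg_basis|].
move=> /(shifted_inj (shifted_redistribute 0 pu pv ee')) E.
by case/eqP: b1b0; apply: val_inj.
Qed.

(** [key] is used for [psi] and again for the symbol 1 with shift 0 at e'. The constants are the
    same and cancel in the quotient. *)
Lemma matrix_coef_redistribute psi p u v e e' j : u != v ->
  (j <= e' u + e' v)%N -> essentially_bounded psi ->
  torus_weight psi p -> rotation_invariant psi u v -> p u = 0 -> p v = 0 ->
  (mdeg e <= m)%N -> (mdeg e' <= m)%N -> shifted p e e' ->
  matrix_coef psi (redistribute e u v j) (redistribute e' u v j) =
  matrix_coef psi (redistribute e u v 0) (redistribute e' u v 0).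
Proof.
move=> uv jN bpsi wpsi rpsi pu pv em em' ee'.
have [c [d [c0 cd]]] := key uv jN em'.
have E1 := cd _ _ _ bpsi wpsi rpsi pu pv em ee'.
have := cd _ (fun=> 0) e' (@essentially_bounded1 R n).
rewrite !one_mul_fun => /(_ _ _ erefl erefl em') E2.
rewrite /matrix_coef; apply/eqP; rewrite eqr_div ?monomial_norm_neq0 ?mdeg_redistribute//.
rewrite -(inj_eq (mulfI c0)) mulrA E1 mulrCA E2; last 1 first.
- by move=> i; rewrite addr0.
- by apply/eqP; ring.
- by move=> i a b z _; rewrite expr0z mul1r.
- by [].
Qed.

(** Inside [B], move one unit of exponent at a time from an index where e exceeds f to one where it
    falls short. *)
Lemma matrix_coef_block psi p (B : pred 'I_n) e e' f f' :
  essentially_bounded psi -> torus_weight psi p ->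
  (forall u v, B u -> B v -> u != v -> rotation_invariant psi u v) ->
  (forall u, B u -> p u = 0) ->
  (mdeg e <= m)%N -> (mdeg e' <= m)%N -> shifted p e e' -> shifted p f f' ->
  (forall i, ~~ B i -> e i = f i) ->
  (\sum_(i < n | B i) e i = \sum_(i < n | B i) f i)%N ->
  matrix_coef psi e e' = matrix_coef psi f f'.
Proof.
move=> bpsi wpsi rpsi pB + + + ff'.
(* With truncated subtraction this is the total excess of e over f, which each move lowers by
   one. *)
have [k] := ubnP (\sum_(i < n) (e i - f i))%N.
elim: k e e' => // k IH e e' ek em em' ee' eB sB.
have [/existsP[v fv]|/existsPn fe] := boolP [exists v, (f v < e v)%N]; last first.
  suff ef : e = f by move: ee' ff'; rewrite ef => h h'; rewrite (shifted_inj h h').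
  have le_ef i : (e i <= f i)%N by rewrite leqNgt fe.
  apply/mnmP => i; have [Bi|/eB//] := boolP (B i).
  apply/eqP; rewrite eqn_leq le_ef /= leqNgt; apply/negP => lt_i.
  have : (\sum_(i < n | B i) e i < \sum_(i < n | B i) f i)%N.
    rewrite (bigD1 i)//= [X in (_ < X)%N](bigD1 i)//= -addSn leq_add//.
    by apply: leq_sum => i' _.
  by rewrite sB ltnn.
have Bv : B v by apply: contraLR fv => /eB ->; rewrite ltnn.
(* The sums over [B] agree, so an excess at [v] forces a deficit at some [u] in [B]. *)
have [/existsP[u /andP[Bu eu]]|/existsPn ef] := boolP [exists u, B u && (e u < f u)%N];
    last first.
  have : (\sum_(i < n | B i) f i < \sum_(i < n | B i) e i)%N.
    rewrite (bigD1 v)//= [X in (_ < X)%N](bigD1 v)//= -addSn leq_add//.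
    apply: leq_sum => i /andP[Bi _]; have := ef i; rewrite Bi /= -leqNgt//.
  by rewrite sB ltnn.
have uv : u != v by apply: contraTneq eu => ->; rewrite -leqNgt ltnW.
have vu : v != u by rewrite eq_sym.
have ue : e' u = e u by have := ee' u; rewrite pB// addr0 => -[].
have ve : e' v = e v by have := ee' v; rewrite pB// addr0 => -[].
have mE j : (j <= e u + e v)%N -> matrix_coef psi (redistribute e u v j)
    (redistribute e' u v j) = matrix_coef psi (redistribute e u v 0)
    (redistribute e' u v 0).
  move=> jN; apply: (matrix_coef_redistribute uv _ bpsi wpsi) => //.
  - by rewrite ue ve.
  - exact: rpsi.
  - exact: pB.
  - exact: pB.
(* [e] is its own redistribution with j = e v. Passing through j = 0 to j = e v - 1 moves one unit
   from [v] to [u]. *)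
rewrite -[in LHS](redistribute_id e uv) -[in LHS](redistribute_id e' uv) ve.
rewrite mE ?leq_addl// -(mE (e v).-1); last by lia.
apply: IH.
- rewrite -ltnS; apply: leq_trans ek; rewrite ltnS.
  rewrite (bigD1 v)//= [X in (_ < X)%N](bigD1 v)//= -addSn leq_add//.
    by rewrite redistributeE (negbTE vu) eqxx; lia.
  apply: leq_sum => i iv; rewrite redistributeE (negbTE iv).
  by case: eqP => [->|//]; lia.
- by rewrite mdeg_redistribute//; lia.
- by rewrite mdeg_redistribute//; lia.
- by apply: shifted_redistribute => //; exact: pB.
- move=> i nBi; rewrite redistributeE.
  by case: eqP nBi => [->|_ nBi]; [rewrite Bu|case: eqP nBi => [->|_ /eB//]; rewrite Bv].
- rewrite -sB (bigD1 u)//= (bigD1 v) ?Bv//= [RHS](bigD1 u)//= [X in _ = (_ + X)%N](bigD1 v) ?Bv//=.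
  rewrite !redistributeE !eqxx (negbTE vu) !addnA; congr (_ + _)%N; first by lia.
  by apply: eq_bigr => i /andP[/andP[_ /negbTE iu] /negbTE iv]; rewrite redistributeE iu iv.
Qed.

End matrix_coefficients.

(** * Commutation *)

Section toeplitz_commute.
Context {R : realType}.
Local Notation C := R[i].
Variables n m : nat.
Implicit Types (e f : multinom n) (p q : 'I_n -> int) (B : pred 'I_n).
Implicit Types (psi phi : n.-tuple C -> C).

Let shifted_sum p e e' B : shifted p e e' -> \sum_(i < n | B i) p i = 0 ->
  (\sum_(i < n | B i) e' i = \sum_(i < n | B i) e i)%N.
Proof.
move=> ee' p0; apply/eqP; rewrite -eqz_nat !(big_morph Posz PoszD erefl); apply/eqP.
by under eq_bigr do rewrite ee'; rewrite big_split /= p0 addr0.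
Qed.

Let shifted_mdeg p e e' B : shifted p e e' -> (forall i, ~~ B i -> p i = 0) ->
  \sum_(i < n | B i) p i = 0 -> mdeg e' = mdeg e.
Proof.
move=> ee' pB p0; rewrite !mdegE (bigID B)/= (shifted_sum ee' p0) [RHS](bigID B)/=.
congr (_ + _)%N; apply: eq_bigr => i /pB pi0.
by have := ee' i; rewrite pi0 addr0 => -[].
Qed.

(** If e' = e + p + q with p supported in [B] and q outside it, this is e + p. In this form its
    entries are visibly nonnegative. *)
Let replace e e' B : multinom n := Multinom [tuple if B i then e' i else e i | i < n].

Let replaceE e e' B i : replace e e' B i = if B i then e' i else e i.
Proof. by rewrite /replace /fun_of_multinom /= tnth_mktuple. Qed.

(** In the product of two weighted shifts only the intermediate index b + p contributes. When b + p
    + q is a multi-index so is b + p, since the supports are disjoint, and it stays in the basis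
    because p has sum 0. *)
Let comp_coef psi phi p q B1 B2 (b b' : bmultinom n m.+1) :
  essentially_bounded psi -> essentially_bounded phi ->
  torus_weight psi p -> torus_weight phi q ->
  (forall i, ~~ B1 i -> p i = 0) -> (forall i, ~~ B2 i -> q i = 0) ->
  (forall i, B1 i -> ~~ B2 i) -> \sum_(i < n | B1 i) p i = 0 ->
  \sum_(b1 : bmultinom n m.+1) matrix_coef m psi (bmnm b) (bmnm b1) *
     matrix_coef m phi (bmnm b1) (bmnm b') =
  if `[< shifted (fun i => p i + q i) (bmnm b) (bmnm b') >] then
    matrix_coef m psi (bmnm b) (replace (bmnm b) (bmnm b') B1) *
    matrix_coef m phi (replace (bmnm b) (bmnm b') B1) (bmnm b')
  else 0.
Proof.
move=> bpsi bphi wpsi wphi p0 q0 B12 sp.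
case: asboolP => [bb'|nbb']; last first.
  apply: big1 => b1 _.
  have [bb1|nbb1] := pselect (shifted p (bmnm b) (bmnm b1)).
    rewrite [X in _ * X]/matrix_coef (bergman_dot_not_shifted bphi wphi).
    - by rewrite mul0r mulr0.
    - exact: mdeg_basis.
    - exact: mdeg_basis.
    - by move=> b1b'; apply: nbb' => i; rewrite b1b' bb1 addrA.
  rewrite /matrix_coef (bergman_dot_not_shifted bpsi wpsi) ?mul0r//.
    exact: mdeg_basis.
  exact: mdeg_basis.
set e1 := replace _ _ _.
have be1 : shifted p (bmnm b) e1.
  move=> i; rewrite replaceE; case: ifPn => [B1i|/p0 ->]; last by rewrite addr0.
  by rewrite bb' (q0 i (B12 i B1i)) addr0.
have e1m : (mdeg e1 < m.+1)%N.
  by rewrite (shifted_mdeg be1 p0 sp) bmdeg.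
rewrite (bigD1 (BMultinom e1m))//= big1 ?addr0// => b1 b1e1.
rewrite /matrix_coef (bergman_dot_not_shifted bpsi wpsi) ?mul0r//.
- exact: mdeg_basis.
- exact: mdeg_basis.
- by move=> /(shifted_inj be1) E; case/eqP: b1e1; apply: val_inj.
Qed.

Lemma toeplitz_commute psi phi p q B1 B2 :
  essentially_bounded psi -> essentially_bounded phi ->
  torus_weight psi p -> torus_weight phi q ->
  (forall i, ~~ B1 i -> p i = 0) -> (forall i, ~~ B2 i -> q i = 0) ->
  (forall i, B1 i -> ~~ B2 i) ->
  \sum_(i < n | B1 i) p i = 0 -> \sum_(i < n | B2 i) q i = 0 ->
  (forall u v, B2 u -> B2 v -> u != v -> rotation_invariant psi u v) ->
  (forall u v, B1 u -> B1 v -> u != v -> rotation_invariant phi u v) ->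
  commute_on_bergman m (toeplitz m psi) (toeplitz m phi).
Proof.
move=> bpsi bphi wpsi wphi p0 q0 B12 sp sq rpsi rphi.
have B21 i : B2 i -> ~~ B1 i by apply: contraL => /B12.
apply: commute_on_bergman_coef => // b b'.
rewrite (comp_coef b b' bpsi bphi wpsi wphi p0 q0 B12 sp).
rewrite (comp_coef b b' bphi bpsi wphi wpsi q0 p0 B21 sq).
have -> : (fun i => q i + p i) = (fun i => p i + q i).
  by apply/funext => i; rewrite addrC.
(* After the swap the coefficients of [psi] at b and at b + q face each other, and so do those of
   [phi] at b + p and at b. *)
case: asboolP => // bb'; rewrite [RHS]mulrC.
set e1 := replace _ _ B1; set e2 := replace _ _ B2.
have be1 : shifted p (bmnm b) e1.
  move=> i; rewrite replaceE; case: ifPn => [/B12/q0 qi|/p0 ->]; last by rewrite addr0.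
  by rewrite bb' qi addr0.
have be2 : shifted q (bmnm b) e2.
  move=> i; rewrite replaceE; case: ifPn => [/B21/p0 pi|/q0 ->]; last by rewrite addr0.
  by rewrite bb' pi add0r.
have e1b' : shifted q e1 (bmnm b').
  move=> i; rewrite replaceE; case: ifPn => [/B12/q0 ->|/p0 pi]; first by rewrite addr0.
  by rewrite bb' pi add0r.
have e2b' : shifted p e2 (bmnm b').
  move=> i; rewrite replaceE; case: ifPn => [/B21/p0 ->|/q0 qi]; first by rewrite addr0.
  by rewrite bb' qi addr0.
have me1 : (mdeg e1 <= m)%N by rewrite (shifted_mdeg be1 p0 sp) mdeg_basis.
congr (_ * _).
  apply: (matrix_coef_block bpsi wpsi rpsi) => //.
  - by move=> u /B21/p0.
  - exact: mdeg_basis.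
  - by move=> i /negbTE B2i; rewrite replaceE B2i.
  - by rewrite (shifted_sum be2 sq).
apply: (matrix_coef_block bphi wphi rphi) => //.
- by move=> u /B12/q0.
- exact: mdeg_basis.
- by move=> i /negbTE B1i; rewrite replaceE B1i.
- by rewrite (shifted_sum be1 sp).
Qed.

End toeplitz_commute.

(** * Integer powers of phases *)

Section phases.
Context {R : realType}.
Local Notation C := R[i].

Definition phase (w : C) : C := w / (normc w)%:C.

(** Only an inequality, since the phase of 0 is 0. *)
Lemma normc_phase_le1 (w : C) : normc (phase w) <= 1.
Proof.
have [->|/eqP w0] := eqVneq w 0; first by rewrite /phase mul0r normc0.
have nw := normc_gt0 w0.
by rewrite /phase normcM normcV normc_real ?normc_ge0// mulfV ?gt_eqF.
Qed.

(* At w = 0 both sides are 0. *)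
Lemma phaseV (w : C) : (phase w)^-1 = ((phase w)^*)%C.
Proof.
have [->|/eqP w0] := eqVneq w 0.
  by rewrite /phase mul0r invr0 conjc0.
have nw := normc_gt0 w0.
rewrite /phase; case: w w0 nw => x y w0 nw.
have N2 : normc (x +i* y) ^+ 2 = x ^+ 2 + y ^+ 2.
  by rewrite sqr_sqrtr// addr_ge0 ?sqr_ge0.
have xy : (x / normc (x +i* y)) ^+ 2 + (y / normc (x +i* y)) ^+ 2 = 1.
  by rewrite !exprMn -mulrDl -N2 exprVn mulfV// expf_neq0// gt_eqF.
rewrite -fmorphV (_ : _ * _ =
  (x / normc (x +i* y)) +i* (y / normc (x +i* y))); last by rewrite /=; simpc.
by rewrite conj_unimodular.
Qed.

(** Negative powers become powers of the conjugate, so bounds and measurability reduce to natural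
    exponents. *)
Lemma phase_expz (w : C) (q : int) : phase w ^ q =
  match q with Posz k => phase w ^+ k | Negz k => ((phase w)^*)%C ^+ k.+1 end.
Proof. by case: q => k //; rewrite NegzE -phaseV exprVn. Qed.

Lemma normc_phase_expz_le1 (w : C) (q : int) : normc (phase w ^ q) <= 1.
Proof.
rewrite phase_expz; case: q => k; rewrite normcX ?normc_conj;
  by rewrite exprn_ile1 ?normc_ge0 ?normc_phase_le1.
Qed.

Lemma measurable_phase_expz d (T : measurableType d) (f : T -> C) (q : int) :
  measurable_fun setT f -> measurable_fun setT (fun x => phase (f x) ^ q).
Proof.
move=> mf; under eq_fun do rewrite phase_expz.
have mp : measurable_fun setT (fun x => phase (f x)) by exact: measurable_funC_div_norm.
by case: q => k; apply: measurable_funCX => //; exact: measurable_funC_conj.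
Qed.

Lemma phaseM (a b : R) (w : C) : a ^+ 2 + b ^+ 2 = 1 ->
  phase ((a +i* b) * w) = (a +i* b) * phase w.
Proof.
move=> ab; rewrite /phase normcM (_ : normc (a +i* b) = 1) ?mul1r ?mulrA//.
by rewrite /normc ab sqrtr1.
Qed.

End phases.

(** * Symmetries and boundedness of the symbols *)

Section symbols.
Context {R : realType}.
Local Notation RR := (measurableTypeR R).
Local Notation C := R[i].
Variables (n l : nat) (k : 'I_l -> nat) (k_gt0 : forall j, (0 < k j)%N)
  (kn : (\sum_(j < l) k j)%N = n).
Local Notation mu := (@lebesgue_complex R n).
Implicit Types (z : n.-tuple C) (p : 'I_n -> int).

Lemma big_block (T : Type) (idx : T) (op : Monoid.com_law idx) (j : 'I_l)
    (F : 'I_n -> T) :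
  \big[op/idx]_(i < k j) F (block_index kn i) =
  \big[op/idx]_(i < n | block_of kn i == j) F i.
Proof.
rewrite -(@big_imset _ _ op _ _ (@block_index n l k kn j) predT F)/=; last first.
  by move=> i i' _ _; exact: block_index_inj.
apply: eq_bigl => i; apply/imsetP/eqP => [[i' _ ->]|<-].
  exact: block_of_index.
by have [i' ii'] := block_indexP kn i; exists i'.
Qed.

Lemma enorm_moduli_block z j : enorm (moduli (block kn z j)) =
  Num.sqrt (\sum_(i < n | block_of kn i == j) normc (tnth z i) ^+ 2).
Proof.
rewrite /enorm -(big_block _ _ (fun i => normc (tnth z i) ^+ 2)); congr Num.sqrt.
by apply: eq_bigr => i _; rewrite !tnth_mktuple.
Qed.

Lemma moduli_phase_rotation z j i (a b : R) : a ^+ 2 + b ^+ 2 = 1 ->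
  moduli (block kn (phase_rotation i (a +i* b) z) j) = moduli (block kn z j).
Proof.
move=> ab; apply: eq_from_tnth => i'; rewrite !tnth_mktuple.
case: eqP => // ->; rewrite normcM (_ : normc (a +i* b) = 1) ?mul1r//.
by rewrite /normc ab sqrtr1.
Qed.

Lemma radii_phase_rotation z i (a b : R) : a ^+ 2 + b ^+ 2 = 1 ->
  radii kn (phase_rotation i (a +i* b) z) = radii kn z.
Proof.
move=> ab; apply: eq_from_tnth => j; rewrite !tnth_mktuple.
by rewrite moduli_phase_rotation.
Qed.

Lemma radii_plane_rotation z u v (a b : R) : a ^+ 2 + b ^+ 2 = 1 -> u != v ->
  block_of kn u = block_of kn v -> radii kn (plane_rotation u v a b z) = radii kn z.
Proof.
move=> ab uv buv; have vu : v != u by rewrite eq_sym.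
apply: eq_from_tnth => j; rewrite !tnth_mktuple !enorm_moduli_block.
congr Num.sqrt; have [uj|uj] := eqVneq (block_of kn u) j.
  have vj : block_of kn v == j by rewrite -buv uj.
  rewrite (bigD1 u) ?uj//= (bigD1 v) ?vj//= [RHS](bigD1 u) ?uj//= [X in _ = _ + X](bigD1 v) ?vj//=.
  rewrite !addrA; congr (_ + _).
    by rewrite !tnth_mktuple !eqxx (negbTE vu) normc_rotation.
  by apply: eq_bigr => i /andP[/andP[_ /negbTE iu] /negbTE iv]; rewrite tnth_mktuple iu iv.
apply: eq_bigr => i /eqP ij; rewrite tnth_mktuple.
case: eqP => [iu|_]; first by rewrite -iu ij eqxx in uj.
by case: eqP => [iv|//]; rewrite buv -iv ij eqxx in uj.
Qed.

Lemma block_plane_rotation z u v (a b : R) j :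
  block_of kn u != j -> block_of kn v != j ->
  block kn (plane_rotation u v a b z) j = block kn z j.
Proof.
move=> uj vj; apply: eq_from_tnth => i; rewrite !tnth_mktuple.
case: eqP => [iu|_]; first by rewrite -iu block_of_index eqxx in uj.
by case: eqP => [iv|//]; rewrite -iv block_of_index eqxx in vj.
Qed.

Lemma phase_monomial_blockE z j p :
  phase_monomial (block kn z j) (fun i => p (block_index kn i)) =
  \prod_(i < n | block_of kn i == j) phase (tnth z i) ^ p i.
Proof.
rewrite -(big_block _ _ (fun i => phase (tnth z i) ^ p i)).
by apply: eq_bigr => i _; rewrite /block tnth_mktuple.
Qed.

Definition block_weight p (j : 'I_l) (i : 'I_n) : int :=
  if block_of kn i == j then p i else 0.

Lemma radial_symbol_torus_weight (a : l.-tuple RR -> C) :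
  torus_weight (radial_symbol kn a) (fun=> 0).
Proof.
by move=> i x y z xy; rewrite expr0z mul1r /radial_symbol radii_phase_rotation.
Qed.

Lemma block_symbol_torus_weight p j (b : l.-tuple RR * (k j).-tuple RR -> C) :
  torus_weight (block_symbol kn p b) (block_weight p j).
Proof.
move=> i x y z xy; rewrite /block_symbol radii_phase_rotation//.
rewrite moduli_phase_rotation// mulrCA; congr (_ * _).
rewrite !phase_monomial_blockE /block_weight.
case: ifPn => [ij|ij]; last first.
  rewrite expr0z mul1r; apply: eq_bigr => i' /eqP i'j; rewrite tnth_mktuple.
  by case: eqP => // ii'; move: ij; rewrite -ii' i'j eqxx.
rewrite (bigD1 i)//= [in RHS](bigD1 i)//= mulrA -expfzMl -phaseM//.
rewrite tnth_mktuple eqxx; congr (_ * _); apply: eq_bigr => i' /andP[_ /negbTE ii'].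
by rewrite tnth_mktuple ii'.
Qed.

Lemma radial_symbol_rotation_invariant (a : l.-tuple RR -> C) u v : u != v ->
  block_of kn u = block_of kn v -> rotation_invariant (radial_symbol kn a) u v.
Proof.
by move=> uv buv x y z xy; rewrite /radial_symbol radii_plane_rotation.
Qed.

Lemma block_symbol_rotation_invariant p j
    (b : l.-tuple RR * (k j).-tuple RR -> C) u v : u != v ->
  block_of kn u = block_of kn v -> block_of kn u != j ->
  rotation_invariant (block_symbol kn p b) u v.
Proof.
move=> uv buv uj x y z xy; rewrite /block_symbol radii_plane_rotation//.
by rewrite block_plane_rotation// -buv.
Qed.

Lemma measurable_positive_orthant d : measurable (@positive_orthant R d).
Proof.
rewrite (_ : @positive_orthant R d =
    [set x | forall i, [set` `[0, +oo[] (tnth x i)]).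
  exact: measurable_cube.
by apply/seteqP; split => x /= xi i; have := xi i; rewrite in_itv/= andbT.
Qed.

Lemma measurable_positive_sphere d : measurable (@positive_sphere R d).
Proof.
rewrite (_ : @positive_sphere R d =
  @positive_orthant R d `&` @enorm R d @^-1` [set 1])//.
apply: measurableI; first exact: measurable_positive_orthant.
by rewrite -[X in measurable X]setTI; apply: measurable_enorm.
Qed.

Lemma positive_orthant_radii z : positive_orthant (radii kn z).
Proof. by move=> j; rewrite tnth_mktuple enorm_ge0. Qed.

Lemma positive_sphere_normalize d (x : d.-tuple RR) : (0 < d)%N ->
  positive_orthant x -> positive_sphere (normalize x).
Proof.
move=> d0 x0; split.
  by move=> i; rewrite tnth_mktuple; case: ifP => _; rewrite ?ler0n// divr_ge0 ?enorm_ge0.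
(* At the origin [normalize] returns the first basis vector, which has norm 1. *)
have [xe|xe] := eqVneq (enorm x) 0.
  rewrite /enorm (bigD1 (Ordinal d0))//= big1 ?addr0.
    by rewrite tnth_mktuple xe eqxx /= expr1n sqrtr1.
  move=> i i0; rewrite tnth_mktuple xe eqxx (_ : (i == 0 :> nat) = false) ?expr0n//.
  by apply/negbTE; apply: contra i0 => /eqP i0; apply/eqP/val_inj.
rewrite (_ : normalize x = [tuple (enorm x)^-1 * tnth x i | i < d]).
  by rewrite enorm_scale ?invr_ge0 ?enorm_ge0// mulVf.
by apply: eq_from_tnth => i; rewrite !tnth_mktuple (negbTE xe) mulrC.
Qed.

Lemma radial_symbol_essentially_bounded (a : l.-tuple RR -> C) (j : 'I_l) :
  Linfty (lebesgue_real l) (@positive_orthant R l) a ->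
  essentially_bounded (radial_symbol kn a).
Proof.
move=> [ma [M [N [mN N0 aN]]]]; split.
  have sub : @radii R n l k kn @` setT `<=` @positive_orthant R l.
    by move=> _ [z _ <-]; exact: positive_orthant_radii.
  exact: (measurable_comp (@measurable_positive_orthant l) sub ma
    (@measurable_radii R n l k kn)).
exists M; apply: negligibleS (radii_negligible k_gt0 kn j mN N0) => z /= aM.
by apply: aN => /= h; apply: aM; apply: h; exact: positive_orthant_radii.
Qed.

Lemma block_symbol_essentially_bounded p j
    (b : l.-tuple RR * (k j).-tuple RR -> C) :
  Linfty (lebesgue_real l \x @sphere_measure R (k j))%E
    (@positive_orthant R l `*` @positive_sphere R (k j)) b ->
  essentially_bounded (block_symbol kn p b).
Proof.
move=> [mb [M [N [mN N0 bN]]]].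
(* Both the measurability and the bound of [b] are given on this set only; every point has its polar
   coordinates in it, by the default value of [normalize]. *)
have inD z : (@positive_orthant R l `*` @positive_sphere R (k j))
    (radii kn z, normalize (moduli (block kn z j))).
  split; first exact: positive_orthant_radii.
  apply: positive_sphere_normalize => // i.
  by rewrite tnth_mktuple normc_ge0.
split.
  apply: measurable_funCM.
    have mD := measurableX (@measurable_positive_orthant l)
      (@measurable_positive_sphere (k j)).
    have sub : (fun z => (radii kn z, normalize (moduli (block kn z j)))) @` setT
        `<=` @positive_orthant R l `*` @positive_sphere R (k j).
      by move=> _ [z _ <-]; exact: inD.
    apply: (measurable_comp mD sub mb).
    by apply: measurable_fun_pair; [exact: measurable_radii|exact: measurable_direction].
  rewrite /phase_monomial; apply: measurable_funC_prod => i.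
  apply: measurable_phase_expz.
  apply: (eq_measurable_fun (fun z : n.-tuple C => tnth z (block_index kn i))).
    by move=> z _; rewrite tnth_mktuple.
  exact: measurable_tnth.
exists M; apply: negligibleS (polar_negligible k_gt0 kn mN N0) => z /= bM.
apply: bN => /= h; apply: bM; rewrite /block_symbol normcM.
rewrite -[leRHS]mulr1 ler_pM ?normc_ge0//; first by apply: h; exact: inD.
rewrite normc_prod; apply: prodr_ile1 => i _.
by rewrite normc_ge0 normc_phase_expz_le1.
Qed.

End symbols.

Lemma block_weight_supp n l (k : 'I_l -> nat) (kn : (\sum_(j < l) k j)%N = n)
    (p : 'I_n -> int) j i : block_of kn i != j -> block_weight kn p j i = 0.
Proof. by rewrite /block_weight => /negbTE ->. Qed.

Lemma block_weight_sum n l (k : 'I_l -> nat) (kn : (\sum_(j < l) k j)%N = n)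
    (p : 'I_n -> int) j : \sum_(i < k j) p (block_index kn i) = 0 ->
  \sum_(i < n | block_of kn i == j) block_weight kn p j i = 0.
Proof.
by move=> p0; rewrite -[RHS]p0 [RHS](big_block kn _ j p); apply: eq_bigr => i ij; rewrite /block_weight ij.
Qed.

Theorem corollary6p4 (R : realType) (n l : nat) (n_gt0 : (0 < n)%N)
    (l_gt0 : (0 < l)%N) (k : 'I_l -> nat) (k_gt0 : forall j, (0 < k j)%N)
    (kn : (\sum_(j < l) k j)%N = n)
    (p : 'I_n -> int)
    (p_sum0 : forall j, \sum_(i < k j) p (block_index kn i) = 0)
    (a : l.-tuple (measurableTypeR R) -> R[i])
    (a_Linfty : Linfty (lebesgue_real l) (@positive_orthant R l) a)
    (b : forall j : 'I_l,
      l.-tuple (measurableTypeR R) * (k j).-tuple (measurableTypeR R) -> R[i])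
    (b_Linfty : forall j : 'I_l,
      Linfty (lebesgue_real l \x @sphere_measure R (k j))%E
        (@positive_orthant R l `*` @positive_sphere R (k j)) (b j))
    (m : nat) :
  (forall j : 'I_l,
    commute_on_bergman m (toeplitz m (radial_symbol kn a))
      (toeplitz m (block_symbol kn p (b j)))) /\
  (forall i j : 'I_l,
    commute_on_bergman m (toeplitz m (block_symbol kn p (b i)))
      (toeplitz m (block_symbol kn p (b j)))).
Proof.
have bounded_b j := block_symbol_essentially_bounded k_gt0 kn p (b_Linfty j).
split=> [j|i j].
  have bounded_a := radial_symbol_essentially_bounded k_gt0 kn j a_Linfty.
  (* The radial symbol has shift 0, so its support is taken empty and the rotation condition on the
     other symbol is vacuous. *)
  apply: (toeplitz_commute (B1 := pred0) (B2 := fun i => block_of kn i == j)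
    bounded_a (bounded_b j) (radial_symbol_torus_weight kn a)
    (block_symbol_torus_weight kn p (b j))) => //.
  - exact: block_weight_supp.
  - by rewrite big_pred0_eq.
  - exact: block_weight_sum.
  - move=> u v /eqP uj /eqP vj uv; apply: radial_symbol_rotation_invariant => //.
    by rewrite uj vj.
have [->|ij] := eqVneq i j; first by [].
apply: (toeplitz_commute (B1 := fun u => block_of kn u == i)
  (B2 := fun u => block_of kn u == j) (bounded_b i) (bounded_b j)
  (block_symbol_torus_weight kn p (b i)) (block_symbol_torus_weight kn p (b j))).
- exact: block_weight_supp.
- exact: block_weight_supp.
- by move=> u /eqP ->.
- exact: block_weight_sum.
- exact: block_weight_sum.
- move=> u v /eqP uj /eqP vj uv; apply: block_symbol_rotation_invariant => //.
    by rewrite uj vj.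
  by rewrite uj eq_sym.
- move=> u v /eqP ui /eqP vi uv; apply: block_symbol_rotation_invariant => //.
    by rewrite ui vi.
  by rewrite ui.
Qed.
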